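(* Let $n,k\in\mathbb N_0$, $0<q<1$, and let $a,b,c,d,e,f\in\mathbb C\setminus\{0\}$ be such that $|a|,|b|,|c|,|f|<1$, where the parameters are such that no denominator below vanishes. Put $$\mathcal I_{n,k}=\int_{-1}^1 p_n(x;a,b,c,d|q)\,p_k(x;a,b,e,f|q)\,w(x;a,b,c,f|q)\,\frac{dx}{\sqrt{1-x^2}}.$$ Then $${}_4\phi_3\!\left(\begin{matrix}q^{-n},q^{n-1}abcd,cf,\frac{qc}{e}\\ cd,\,q^kabcf,\,q^{1-k}\frac ce\end{matrix};q,q\right)=c^{n-k}\,\frac{(q,cf,q^nac,q^nbc,q^kab,q^kaf,q^kbf;q)_\infty}{2\pi\,(cd;q)_n(\frac ec;q)_k(q^kabcf;q)_\infty}\,\mathcal I_{n,k},$$ $${}_4\phi_3\!\left(\begin{matrix}q^{-k},q^{k-1}abef,cf,\frac{qf}{d}\\ ef,\,q^nabcf,\,q^{1-n}\frac fd\end{matrix};q,q\right)=f^{k-n}\,\frac{(q,cf,q^nab,q^nac,q^nbc,q^kaf,q^kbf;q)_\infty}{2\pi\,(\frac df;q)_n(ef;q)_k(q^nabcf;q)_\infty}\,\mathcal I_{n,k}.$$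
   Context: $(a;q)_n=\prod_{j=0}^{n-1}(1-aq^j)$, $(a;q)_\infty=\lim_{n\to\infty}(a;q)_n$, $(a_1,\dots,a_k;q)_n=\prod_i(a_i;q)_n$. The series ${}_4\phi_3$ is ${}_4\phi_3\!\left(\begin{matrix}a_1,\dots,a_4\\ b_1,b_2,b_3\end{matrix};q,z\right)=\sum_{j\ge0}\frac{(a_1,\dots,a_4;q)_j}{(q,b_1,b_2,b_3;q)_j}z^j$, with $b_i\notin\{q^{-j}:j\in\mathbb N_0\}$. With $x=\frac12(z+z^{-1})$, the Askey--Wilson polynomials are $$p_n(x;a,b,c,d|q)=a^{-n}(ab,ac,ad;q)_n\,{}_4\phi_3\!\left(\begin{matrix}q^{-n},q^{n-1}abcd,az,az^{-1}\\ ab,ac,ad\end{matrix};q,q\right)$$ (symmetric in $a,b,c,d$), and the weight function is $$w(x;a,b,c,d|q)=\frac{(z^2,z^{-2};q)_\infty}{(az,az^{-1},bz,bz^{-1},cz,cz^{-1},dz,dz^{-1};q)_\infty}.$$ *)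

(* Defs.v *)
From Stdlib Require Import Reals ZArith List Lra.
From Coquelicot Require Import Coquelicot.
Import ListNotations.

Local Open Scope C_scope.

(** Componentwise limit of a complex sequence; total, and correct on every
    convergent sequence by [CLim_seq_unique]. *)
Definition CLim_seq (u : nat -> C) : C :=
  (real (Lim_seq (fun n => Re (u n))), real (Lim_seq (fun n => Im (u n)))).

Lemma CLim_seq_unique (u : nat -> C) (l : C) :
  filterlim u eventually (locally l) -> CLim_seq u = l.
Proof.
intros H.
assert (Hre : is_lim_seq (fun n => Re (u n)) (Re l)).
{ apply (filterlim_comp _ _ _ u Re _ _ _ H).
  intros P [e He]; exists e; intros y Hy; apply He, Hy. }
assert (Him : is_lim_seq (fun n => Im (u n)) (Im l)).
{ apply (filterlim_comp _ _ _ u Im _ _ _ H).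
  intros P [e He]; exists e; intros y Hy; apply He, Hy. }
unfold CLim_seq.
rewrite (is_lim_seq_unique _ _ Hre), (is_lim_seq_unique _ _ Him).
now destruct l.
Qed.

Fixpoint qpoch (a : C) (q : R) (n : nat) : C :=
  match n with
  | O => 1
  | S m => qpoch a q m * (1 - a * q ^ m)
  end.

Definition qpoch_inf (a : C) (q : R) : C := CLim_seq (qpoch a q).

Definition qpochs (l : list C) (q : R) (n : nat) : C :=
  fold_right (fun a r => qpoch a q n * r) 1 l.

Definition qpochs_inf (l : list C) (q : R) : C :=
  fold_right (fun a r => qpoch_inf a q * r) 1 l.

(** Integer power of the real base, as a complex number: [q^m] for [m : Z]. *)
Definition qpow (q : R) (m : Z) : C := RtoC (powerRZ q m).

(** The convention [/ 0 = 0] of [C] is harmless in a series terminated by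
    [a1 = q^(-n)]: all terms of index [j > n] carry the factor
    [(q^(-n);q)_j = 0], and the terms of index [j <= n] are genuine as soon as
    [(b;q)_n <> 0] for each lower parameter [b]. *)
Definition phi43 (a1 a2 a3 a4 b1 b2 b3 : C) (q : R) (z : C) : C :=
  CLim_seq (sum_n (fun j : nat =>
    qpochs [a1; a2; a3; a4] q j / qpochs [RtoC q; b1; b2; b3] q j * z ^ j)).

(** A root [z] of [x = (z + 1/z)/2] for [x] in [[-1,1]].  The other root is
    [1/z], and the functions below are invariant under [z <-> 1/z]. *)
Definition zof (x : R) : C := (x, sqrt (1 - x ^ 2)).

Lemma zof_spec (x : R) :
  (-1 <= x <= 1)%R -> RtoC x = (zof x + / zof x) / 2.
Proof.
intros Hx.
assert (H0 : (0 <= 1 - x ^ 2)%R) by nra.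
assert (Hs := sqrt_sqrt _ H0).
set (s := sqrt (1 - x ^ 2)) in *.
assert (Hn : (x ^ 2 + s ^ 2 = 1)%R) by (simpl in *; lra).
unfold zof; fold s.
assert (Hinv : / (x, s) = ((x, - s)%R : C)).
{ unfold Cinv; cbn [fst snd]; rewrite Hn; f_equal; field. }
rewrite Hinv; unfold Cdiv, Cplus, Cmult, Cinv, RtoC; cbn [fst snd].
f_equal; field.
Qed.

(** [p_n(x;a,b,c,d|q)] with [x = (z + 1/z)/2]. *)
Definition askey_wilson (n : nat) (z a b c d : C) (q : R) : C :=
  / a ^ n * qpochs [a * b; a * c; a * d] q n
  * phi43 (qpow q (- Z.of_nat n)) (qpow q (Z.of_nat n - 1) * (a * b * c * d))
          (a * z) (a / z) (a * b) (a * c) (a * d) q q.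

(** [w(x;a,b,c,d|q)] with [x = (z + 1/z)/2]. *)
Definition aw_weight (z a b c d : C) (q : R) : C :=
  qpochs_inf [z ^ 2; / z ^ 2] q
  / qpochs_inf [a * z; a / z; b * z; b / z; c * z; c / z; d * z; d / z] q.

(** For [|a|,|b|,|c|,|f| < 1] the weight carries a factor [1 - x^2], so the
    integrand is continuous on [(-1,1)] with limit [0] at both endpoints: the
    integral is a proper Riemann integral. *)
Definition aw_integral (n k : nat) (a b c d e f : C) (q : R) : C :=
  RInt (V := C_R_CompleteNormedModule)
    (fun x : R =>
       askey_wilson n (zof x) a b c d q * askey_wilson k (zof x) a b e f q
       * aw_weight (zof x) a b c f q * RtoC (/ sqrt (1 - x ^ 2)))
    (-1) 1.

(* Main.v *)
(** Expand [p_n(x;a,b,c,d)] in the basis [(cz,c/z;q)_j] (allowed by the symmetry of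
    [p_n] in its parameters) and [p_k(x;a,b,e,f)] in the basis [(az,a/z;q)_i].  The
    product of the two basis elements turns the weight [w(a,b,c,f)] into
    [w(aq^i,b,cq^j,f)], whose integral is given by the Askey--Wilson formula.  The sum
    over [i] is then a terminating balanced 3phi2, summed by q-Saalschütz, and the
    remaining sum over [j] is the 4phi3.  The second identity is the first one with
    [(n,c,d)] and [(k,f,e)] exchanged.  The symmetry of [p_n] also reduces to
    q-Saalschütz, applied once to the connection coefficients and once to the inner sum.

    For the Askey--Wilson integral, moving the contour from [|z| = 1] to [|z| = q] in
    the integral of
      [z (z^2,q/z^2;q)_oo / prod_t (tz,tq/z;q)_oo]    (t = a,b,c,d)
    gives [(1-abcd) I(aq,b,c,d) = (1-ab)(1-ac)(1-ad) I(a,b,c,d)].  So the quotient of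
    [I] by the expected value is invariant under multiplying all parameters by [q],
    hence constant, being continuous at the origin; the parameters
    [(q,-q,sqrt q,-sqrt q)], for which [w = (1-z^2)(1-z^-2)], give the constant. *)

Require Import Defs.
From Stdlib Require Import Reals ZArith List.
From Coquelicot Require Import Coquelicot.
From Stdlib Require Import Lra Lia FunctionalExtensionality.
Import ListNotations.
Local Open Scope C_scope.

Fixpoint csum (f : nat -> C) (n : nat) : C :=
  match n with O => 0 | S m => csum f m + f m end.

Lemma csum_ext (f g : nat -> C) (n : nat) :
  (forall j, (j < n)%nat -> f j = g j) -> csum f n = csum g n.
Proof.
induction n as [|n IH]; intros H; simpl; [easy|].
rewrite IH, H by (intros; try apply H; lia); easy.
Qed.

Lemma csum_plus (f g : nat -> C) (n : nat) :
  csum (fun j => f j + g j) n = csum f n + csum g n.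
Proof. induction n as [|n IH]; simpl; [|rewrite IH]; ring. Qed.

Lemma csum_scal (c : C) (f : nat -> C) (n : nat) :
  csum (fun j => c * f j) n = c * csum f n.
Proof. induction n as [|n IH]; simpl; [|rewrite IH]; ring. Qed.

Lemma csum_triangle (f : nat -> nat -> C) (n : nat) :
  csum (fun j => csum (f j) (S j)) n
  = csum (fun i => csum (fun l => f (i + l)%nat i) (n - i)) n.
Proof.
induction n as [|n IH]; [easy|].
change (csum (fun j => csum (f j) (S j)) n + csum (f n) (S n)
  = csum (fun i => csum (fun l => f (i + l)%nat i) (S n - i)) (S n)).
rewrite IH.
change (csum (fun i => csum (fun l => f (i + l)%nat i) (n - i)) n
    + (csum (f n) n + f n n)
  = csum (fun i => csum (fun l => f (i + l)%nat i) (S n - i)) n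
    + csum (fun l => f (n + l)%nat n) (S n - n)).
replace (S n - n)%nat with 1%nat by lia; cbn [csum].
rewrite (csum_ext (fun i => csum (fun l => f (i + l)%nat i) (S n - i))
  (fun i => csum (fun l => f (i + l)%nat i) (n - i) + f n i)).
- rewrite csum_plus, Nat.add_0_r; ring.
- intros i Hi; rewrite Nat.sub_succ_l by lia; cbn [csum].
  do 2 f_equal; lia.
Qed.

Lemma qpoch_shift (a : C) (q : R) (n : nat) :
  qpoch a q (S n) = (1 - a) * qpoch (a * q) q n.
Proof.
induction n as [|n IH]; [simpl; ring|].
change (qpoch a q (S (S n))) with (qpoch a q (S n) * (1 - a * q ^ S n)).
rewrite IH; cbn [qpoch]; rewrite Cpow_S; ring.
Qed.

Lemma qpoch_add (a : C) (q : R) (m n : nat) :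
  qpoch a q (m + n) = qpoch a q m * qpoch (a * q ^ m) q n.
Proof.
induction n as [|n IH]; [rewrite Nat.add_0_r; simpl; ring|].
rewrite Nat.add_succ_r; cbn [qpoch]; rewrite IH, Cpow_add_r; ring.
Qed.

Lemma Cmod_q (q : R) : (0 < q < 1)%R -> Cmod q = q.
Proof. intros H; rewrite Cmod_R, Rabs_pos_eq; lra. Qed.

Lemma RtoC_neq_0 (x : R) : x <> 0%R -> RtoC x <> 0.
Proof. intros H E; apply H, RtoC_inj, E. Qed.

Lemma one_minus_neq_0 (u : C) : (Cmod u < 1)%R -> 1 - u <> 0.
Proof.
intros H E; assert (u = 1) as -> by (replace u with (1 - (1 - u)) by ring; rewrite E; ring).
rewrite Cmod_1 in H; lra.
Qed.

Lemma pow_le_1 (q : R) (n : nat) : (0 < q < 1)%R -> (0 < q ^ n <= 1)%R.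
Proof.
intros H; split; [apply pow_lt; lra|].
induction n as [|n IH]; simpl; [lra|].
assert (0 < q ^ n)%R by (apply pow_lt; lra); nra.
Qed.

Lemma Cmod_qpow_mult (a : C) (q : R) (n : nat) :
  (0 < q < 1)%R -> (Cmod (a * q ^ n) <= Cmod a)%R.
Proof.
intros H; rewrite Cmod_mult, Cmod_pow, Cmod_q by easy.
generalize (pow_le_1 q n H) (Cmod_ge_0 a); nra.
Qed.

Lemma qpoch_neq_0 (a : C) (q : R) (n : nat) :
  (0 < q < 1)%R -> (Cmod a < 1)%R -> qpoch a q n <> 0.
Proof.
intros Hq Ha; induction n as [|n IH]; simpl; [apply C1_nz|].
apply Cmult_neq_0; [easy|]; apply one_minus_neq_0.
eapply Rle_lt_trans; [apply Cmod_qpow_mult|]; easy.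
Qed.

Lemma qq_neq_0 (q : R) (n : nat) : (0 < q < 1)%R -> qpoch q q n <> 0.
Proof. intros H; apply qpoch_neq_0; [easy|rewrite Cmod_q; lra]. Qed.

(** * The q-Saalschütz sum and the symmetry of the Askey--Wilson polynomials *)

Definition saal_term (A B x : C) (q : R) (j r : nat) : C :=
  qpoch q q (j + r) / (qpoch q q j * qpoch q q r)
  * (qpoch A q j * qpoch B q j * (qpoch x q r * x ^ j)
     * qpoch (A * B * x * q ^ j) q r).

(* WZ pair: the right-hand side is the certificate [G (m + 1)], the summand being
   [G (j + 1) - G j]. *)
Lemma saal_wz (A B x : C) (q : R) (m r : nat) : (0 < q < 1)%R ->
  csum (fun j => saal_term A B x q j (S (m + r) - j)
     - (1 - A * x * q ^ (m + r)) * (1 - B * x * q ^ (m + r))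
       * saal_term A B x q j (m + r - j)) (S m)
  = - q ^ r * (qpoch q q (m + r) / (qpoch q q m * qpoch q q r))
    * (qpoch A q (S m) * qpoch B q (S m) * (qpoch x q r * x ^ S m)
       * qpoch (A * B * x * q ^ m) q r).
Proof.
intros Hq; revert r; induction m as [|m IH]; intros r.
- cbn [csum]; unfold saal_term.
  rewrite !Nat.sub_0_r, !Nat.add_0_l; cbn [qpoch]; simpl (_ ^ 0).
  generalize (qq_neq_0 q (S r) Hq) (qq_neq_0 q r Hq); cbn [qpoch]; intros H1 H2.
  assert (1 - q * q ^ r <> 0) by (intros E; apply H1; rewrite E; ring).
  rewrite Cpow_S; simpl (x ^ 0); field; easy.
- cbn [csum]. cbn [csum] in IH.
  replace (S m + r)%nat with (m + S r)%nat by lia.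
  rewrite IH; clear IH.
  replace (S (m + S r) - S m)%nat with (S r) by lia.
  replace (m + S r - S m)%nat with r by lia.
  unfold saal_term.
  replace (S m + S r)%nat with (S (S (m + r))) by lia.
  replace (m + S r)%nat with (S (m + r)) by lia.
  replace (S m + r)%nat with (S (m + r)) by lia.
  rewrite (qpoch_shift (A * B * x * q ^ m) q r).
  replace (A * B * x * q ^ m * q) with (A * B * x * q ^ S m) by (rewrite Cpow_S; ring).
  generalize (qq_neq_0 q (S r) Hq) (qq_neq_0 q r Hq) (qq_neq_0 q (S m) Hq) (qq_neq_0 q m Hq).
  cbn [qpoch]; intros H1 H2 H3 H4.
  assert (1 - q * q ^ r <> 0) by (intros E; apply H1; rewrite E; ring).
  assert (1 - q * q ^ m <> 0) by (intros E; apply H3; rewrite E; ring).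
  rewrite !Cpow_S, !Cpow_add_r.
  field; easy.
Qed.

Lemma q_saalschutz (A B x : C) (q : R) (n : nat) : (0 < q < 1)%R ->
  csum (fun j => saal_term A B x q j (n - j)) (S n)
  = qpoch (A * x) q n * qpoch (B * x) q n.
Proof.
intros Hq; induction n as [|n IH].
- unfold saal_term; simpl; field; apply C1_nz.
- generalize (saal_wz A B x q n 0 Hq); rewrite Nat.add_0_r; intros H.
  cbn [csum]; rewrite Nat.sub_diag.
  rewrite (csum_ext _ (fun j => saal_term A B x q j (S n - j)
     + - ((1 - A * x * q ^ n) * (1 - B * x * q ^ n))
       * saal_term A B x q j (n - j))) in H by (intros; ring).
  rewrite csum_plus in H.
  rewrite csum_scal, IH in H; cbn [csum] in H.
  match type of H with ?u + ?v = ?w => assert (E : u = w - v) by (rewrite <- H; ring) end.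
  rewrite E.
  unfold saal_term; rewrite Nat.add_0_r.
  generalize (qq_neq_0 q (S n) Hq) (qq_neq_0 q n Hq); intros H1 H2.
  cbn [qpoch]; cbn [qpoch] in H1; simpl (_ ^ 0).
  assert (1 - q * q ^ n <> 0) by (intros E'; apply H1; rewrite E'; ring).
  field; split; easy.
Qed.

Lemma Cmult_cancel_l (c u v : C) : c <> 0 -> c * u = c * v -> u = v.
Proof.
intros H E; replace u with (/ c * (c * u)) by (field; easy).
rewrite E; field; easy.
Qed.

Lemma Cinv_neq_0 (u : C) : u <> 0 -> / u <> 0.
Proof.
intros H E; apply C1_nz; rewrite <- (Cinv_r u H), E; ring.
Qed.

Lemma Cq_neq_0 (q : R) : (0 < q < 1)%R -> RtoC q <> 0.
Proof. intros H; apply RtoC_neq_0; lra. Qed.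

Definition qbin_inv (q : R) (n j : nat) : C :=
  qpoch (/ q ^ n) q j * q ^ j / qpoch q q j.

Lemma qpoch_reverse (y : C) (q : R) (n r j : nat) :
  (0 < q < 1)%R -> y <> 0 -> n = (j + r)%nat ->
  qpoch (y * q ^ j) q r * (qpoch (/ q ^ n) q j * q ^ j) * qpoch q q r
  = qpoch (/ q ^ n) q n * q ^ n / (q / (q ^ n * y)) ^ n
    * (qpoch (q / (q ^ n * y)) q r * (q / (q ^ n * y)) ^ j).
Proof.
intros Hq Hy; revert j; induction r as [|r IH]; intros j Hn;
  assert (Hq0 := Cq_neq_0 q Hq);
  assert (Hn0 : RtoC q ^ n <> 0) by (apply Cpow_nz; easy);
  assert (Hx : q / (q ^ n * y) <> 0)
    by (apply Cmult_neq_0; [easy|]; apply Cinv_neq_0, Cmult_neq_0; easy).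
- rewrite Nat.add_0_r in Hn; subst j; simpl (qpoch _ _ 0).
  field; repeat split; try easy; apply Cpow_nz; easy.
- specialize (IH (S j) ltac:(lia)).
  assert (H1 : 1 - / q ^ n * q ^ j <> 0).
  { replace (1 - / q ^ n * q ^ j) with (- (1 - q * q ^ r) / (q * q ^ r)).
    - generalize (qq_neq_0 q (S r) Hq); cbn [qpoch]; intros H1.
      apply Cmult_neq_0.
      + intros E; apply H1.
        replace (1 - q * q ^ r) with (- - (1 - q * q ^ r)) by ring.
        rewrite E; ring.
      + apply Cinv_neq_0, Cmult_neq_0; [easy|apply Cpow_nz; easy].
    - rewrite Hn, Cpow_add_r, Cpow_S.
      field; repeat split; try easy; apply Cpow_nz; easy. }
  set (K := qpoch (/ q ^ n) q n * q ^ n / (q / (q ^ n * y)) ^ n) in *.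
  assert (E : q / (q ^ n * y) * q ^ r = / (y * q ^ j)).
  { rewrite Hn, Cpow_add_r, Cpow_S.
    field; repeat split; try easy; apply Cpow_nz; easy. }
  assert (Hj : RtoC q ^ j <> 0) by (apply Cpow_nz; easy).
  assert (Hr : RtoC q ^ r <> 0) by (apply Cpow_nz; easy).
  rewrite qpoch_shift.
  replace (y * q ^ j * q) with (y * q ^ S j) by (rewrite Cpow_S; ring).
  cbn [qpoch] in IH |- *; rewrite E; rewrite !Cpow_S in IH.
  set (X := q / (q ^ n * y)) in *.
  assert (EX : q * (1 - / q ^ n * q ^ j) * (- y * q ^ j)
               = X * ((y * q ^ j) * (1 - q * q ^ r)) * (y * q ^ j)).
  { unfold X; rewrite Hn, Cpow_add_r, Cpow_S; field; repeat split; easy. }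
  apply Cmult_cancel_l with (q * (1 - / q ^ n * q ^ j)); [now apply Cmult_neq_0|].
  rewrite Cpow_S; set (Y := qpoch (y * (q * q ^ j)) q r) in *.
  set (Z := qpoch (/ q ^ n) q j) in *.
  set (W := qpoch q q r) in *.
  transitivity ((Y * (Z * (1 - / q ^ n * q ^ j) * (q * q ^ j)) * W)
     * ((1 - y * q ^ j) * (1 - q * q ^ r))); [ring|].
  rewrite IH.
  transitivity (K * (qpoch X q r * X ^ j)
    * ((X * ((y * q ^ j) * (1 - q * q ^ r)) * (y * q ^ j))
       * (1 - y * q ^ j) / ((y * q ^ j) * (y * q ^ j)))); [field; split; easy|].
  rewrite <- EX; field; split; easy.
Qed.

Lemma q_saalschutz_balanced (B u v : C) (q : R) (n : nat) :
  (0 < q < 1)%R -> B <> 0 -> v <> 0 ->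
  csum (fun j => qbin_inv q n j * qpoch (B * u * v * q ^ n / q) q j * qpoch B q j
     * qpoch (B * u * q ^ j) q (n - j) * qpoch (B * v * q ^ j) q (n - j)) (S n)
  = B ^ n * qpoch u q n * qpoch v q n.
Proof.
intros Hq HB Hv.
assert (Hq0 := Cq_neq_0 q Hq).
assert (Hn0 : RtoC q ^ n <> 0) by (apply Cpow_nz; easy).
assert (Hy : B * v <> 0) by (apply Cmult_neq_0; easy).
set (x := q / (q ^ n * (B * v))).
set (N := qpoch (/ q ^ n) q n * q ^ n / x ^ n).
assert (Hx : x <> 0)
  by (apply Cmult_neq_0; [easy|]; apply Cinv_neq_0, Cmult_neq_0; easy).
rewrite (csum_ext _ (fun j => N / qpoch q q n
  * saal_term (B * u * v * q ^ n / q) B x q j (n - j))).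
- rewrite csum_scal, q_saalschutz by easy.
  replace (B * u * v * q ^ n / q * x) with u
    by (unfold x; field; repeat split; easy).
  generalize (qpoch_reverse v q n n 0 Hq Hv eq_refl); simpl (_ ^ 0); simpl (qpoch _ _ 0).
  rewrite !Cmult_1_r; intros E.
  replace (B * x) with (q / (q ^ n * v))
    by (unfold x; field; repeat split; easy).
  set (w := q / (q ^ n * v)) in *.
  assert (Hw : w <> 0)
    by (apply Cmult_neq_0; [easy|]; apply Cinv_neq_0, Cmult_neq_0; easy).
  assert (Ew : w ^ n = B ^ n * x ^ n).
  { rewrite <- Cpow_mult_l; f_equal; unfold w, x; field; repeat split; easy. }
  assert (Hxn : x ^ n <> 0) by (apply Cpow_nz; easy).
  assert (HBn : B ^ n <> 0) by (apply Cpow_nz; easy).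
  assert (Hqq := qq_neq_0 q n Hq).
  transitivity (B ^ n * qpoch u q n * (qpoch v q n * qpoch q q n) / qpoch q q n);
    [|field; easy].
  rewrite E, Ew; unfold N; field; repeat split; easy.
- intros j Hj.
  generalize (qpoch_reverse (B * v) q n (n - j) j Hq Hy ltac:(lia)).
  fold x; fold N; intros E.
  unfold saal_term, qbin_inv.
  replace (j + (n - j))%nat with n by lia.
  replace (B * u * v * q ^ n / q * B * x) with (B * u)
    by (unfold x; field; repeat split; easy).
  generalize (qq_neq_0 q j Hq) (qq_neq_0 q (n - j) Hq) (qq_neq_0 q n Hq); intros H1 H2 H3.
  transitivity (qpoch (B * u * v * q ^ n / q) q j * qpoch B q j
     * qpoch (B * u * q ^ j) q (n - j)
     * (qpoch (B * v * q ^ j) q (n - j) * (qpoch (/ q ^ n) q j * q ^ j)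
        * qpoch q q (n - j)) / (qpoch q q j * qpoch q q (n - j)));
    [field; split; easy|].
  rewrite E; field; repeat split; easy.
Qed.

(* Polynomial form of [p_n]: no nonvanishing of [(ab,ac,ad;q)_n] is needed. *)
Definition aw_cleared (n : nat) (z a b c d : C) (q : R) : C :=
  / a ^ n * csum (fun j => qbin_inv q n j
     * qpoch (q ^ n / q * (a * b * c * d)) q j
     * (qpoch (a * b * q ^ j) q (n - j) * qpoch (a * c * q ^ j) q (n - j)
        * qpoch (a * d * q ^ j) q (n - j))
     * (qpoch (a * z) q j * qpoch (a / z) q j)) (S n).

Lemma qbin_inv_add (q : R) (i l m : nat) : (0 < q < 1)%R ->
  qbin_inv q (i + m) (i + l)
  * (qpoch q q (i + l) / (qpoch q q i * qpoch q q l))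
  = qbin_inv q (i + m) i * qbin_inv q m l.
Proof.
intros Hq; unfold qbin_inv; rewrite (qpoch_add (/ _)), !Cpow_add_r.
assert (Hq0 := Cq_neq_0 q Hq).
assert (Hi : RtoC q ^ i <> 0) by (apply Cpow_nz; easy).
assert (Hm : RtoC q ^ m <> 0) by (apply Cpow_nz; easy).
replace (/ (q ^ i * q ^ m) * q ^ i) with (/ q ^ m) by (field; split; easy).
generalize (qq_neq_0 q i Hq) (qq_neq_0 q l Hq) (qq_neq_0 q (i + l) Hq); intros.
field; repeat split; easy.
Qed.

Lemma aw_connection (a c z : C) (q : R) (j : nat) :
  (0 < q < 1)%R -> a <> 0 -> c <> 0 -> z <> 0 ->
  qpoch (a * z) q j * qpoch (a / z) q j
  = csum (fun i => qpoch q q j / (qpoch q q i * qpoch q q (j - i))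
      * (qpoch (c * z) q i * qpoch (c / z) q i)
      * (qpoch (a / c) q (j - i) * (a / c) ^ i)
      * qpoch (a * c * q ^ i) q (j - i)) (S j).
Proof.
intros Hq Ha Hc Hz.
replace (a * z) with (c * z * (a / c)) by (field; easy).
replace (a / z) with (c / z * (a / c)) by (field; easy).
rewrite <- q_saalschutz by easy; apply csum_ext; intros i Hi.
unfold saal_term; replace (i + (j - i))%nat with j by lia.
replace (c * z * (c / z) * (a / c)) with (a * c) by (field; easy).
ring.
Qed.

Lemma aw_cleared_sym (n : nat) (z a b c d : C) (q : R) :
  (0 < q < 1)%R -> a <> 0 -> c <> 0 -> z <> 0 -> d <> 0 ->
  aw_cleared n z a b c d q = aw_cleared n z c b a d q.
Proof.
intros Hq Ha Hc Hz Hd.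
assert (Hq0 := Cq_neq_0 q Hq).
set (A := q ^ n / q * (a * b * c * d)).
assert (Han : a ^ n <> 0) by (apply Cpow_nz; easy).
assert (Hcn : c ^ n <> 0) by (apply Cpow_nz; easy).
unfold aw_cleared; fold A.
replace (q ^ n / q * (c * b * a * d)) with A by (unfold A; ring).
set (F := fun j i =>
  qbin_inv q n j * qpoch A q j
  * (qpoch (a * b * q ^ j) q (n - j) * qpoch (a * c * q ^ j) q (n - j)
     * qpoch (a * d * q ^ j) q (n - j))
  * (qpoch q q j / (qpoch q q i * qpoch q q (j - i))
      * (qpoch (c * z) q i * qpoch (c / z) q i)
      * (qpoch (a / c) q (j - i) * (a / c) ^ i)
      * qpoch (a * c * q ^ i) q (j - i))).
rewrite (csum_ext _ (fun j => csum (F j) (S j))).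
2:{ intros j Hj; unfold F; rewrite csum_scal; f_equal.
    apply aw_connection; easy. }
rewrite csum_triangle, <- !csum_scal; apply csum_ext; intros i Hi.
replace (S n - i)%nat with (S (n - i)) by lia.
assert (En : n = (i + (n - i))%nat) by lia.
set (m := (n - i)%nat) in *.
assert (Hi0 : RtoC q ^ i <> 0) by (apply Cpow_nz; easy).
assert (Hm0 : RtoC q ^ m <> 0) by (apply Cpow_nz; easy).
rewrite (csum_ext _ (fun l =>
  qbin_inv q n i * qpoch A q i * qpoch (c * a * q ^ i) q m
  * (qpoch (c * z) q i * qpoch (c / z) q i) * (a / c) ^ i
  * (qbin_inv q m l
     * qpoch (a / c * (b * c * q ^ i) * (c * d * q ^ i) * q ^ m / q) q l
     * qpoch (a / c) q l
     * qpoch (a / c * (b * c * q ^ i) * q ^ l) q (m - l)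
     * qpoch (a / c * (c * d * q ^ i) * q ^ l) q (m - l)))).
- rewrite csum_scal, q_saalschutz_balanced; try easy.
  2:{ apply Cmult_neq_0; [easy|apply Cinv_neq_0; easy]. }
  2:{ repeat apply Cmult_neq_0; easy. }
  replace (c * b * q ^ i) with (b * c * q ^ i) by ring.
  assert (E : (a / c) ^ i * (a / c) ^ m * / a ^ n = / c ^ n).
  { rewrite <- Cpow_add_r, <- En; unfold Cdiv.
    rewrite Cpow_mult_l, Cpow_inv by easy; field; easy. }
  rewrite <- E; ring.
- intros l Hl; unfold F.
  replace (n - (i + l))%nat with (m - l)%nat by lia.
  replace (i + l - i)%nat with l by lia.
  assert (E := qbin_inv_add q i l m Hq); rewrite <- En in E.
  rewrite (qpoch_add A), (Cmult_comm c a).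
  replace m with (l + (m - l))%nat at 4 by lia.
  rewrite (qpoch_add (a * c * q ^ i)).
  replace (a / c * (b * c * q ^ i) * (c * d * q ^ i) * q ^ m / q) with (A * q ^ i).
  2:{ unfold A; rewrite En, Cpow_add_r; field; easy. }
  replace (a / c * (b * c * q ^ i) * q ^ l) with (a * b * q ^ (i + l))
    by (rewrite Cpow_add_r; field; easy).
  replace (a / c * (c * d * q ^ i) * q ^ l) with (a * d * q ^ (i + l))
    by (rewrite Cpow_add_r; field; easy).
  replace (a * c * q ^ i * q ^ l) with (a * c * q ^ (i + l))
    by (rewrite Cpow_add_r; ring).
  match goal with |- ?L = ?R' =>
    transitivity ((qbin_inv q n (i + l) * (qpoch q q (i + l) / (qpoch q q i * qpoch q q l)))
     * (qpoch A q i * qpoch (A * q ^ i) q l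
     * (qpoch (a * b * q ^ (i + l)) q (m - l) * qpoch (a * c * q ^ (i + l)) q (m - l)
     * qpoch (a * d * q ^ (i + l)) q (m - l))
     * ((qpoch (c * z) q i * qpoch (c / z) q i)
      * (qpoch (a / c) q l * (a / c) ^ i)
      * qpoch (a * c * q ^ i) q l))) end; [ring|].
  rewrite E; ring.
Qed.

Lemma Re_minus (u v : C) : Re (u - v) = (Re u - Re v)%R.
Proof. reflexivity. Qed.

Lemma Im_minus (u v : C) : Im (u - v) = (Im u - Im v)%R.
Proof. reflexivity. Qed.

Lemma im_le_Cmod (u : C) : (Rabs (Im u) <= Cmod u)%R.
Proof. eapply Rle_trans; [apply Rmax_r|apply Rmax_Cmod]. Qed.

Lemma Cmod_le_Rabs_plus (u : C) : (Cmod u <= Rabs (Re u) + Rabs (Im u))%R.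
Proof.
replace u with (RtoC (Re u) + RtoC (Im u) * Ci) at 1.
- eapply Rle_trans; [apply Cmod_triangle|].
  rewrite Cmod_mult, !Cmod_R, Cmod_Ci; lra.
- destruct u; unfold Cplus, Cmult, Ci, RtoC; simpl; f_equal; ring.
Qed.

Lemma Cmod_minus_sym (u v : C) : Cmod (u - v) = Cmod (v - u).
Proof. rewrite <- Cmod_opp; f_equal; ring. Qed.

Lemma Cmod_triangle3 (u v w : C) :
  (Cmod (u - w) <= Cmod (u - v) + Cmod (v - w))%R.
Proof. replace (u - w) with ((u - v) + (v - w)) by ring; apply Cmod_triangle. Qed.

Lemma Cmod_one_minus_le (u : C) : (1 - Cmod u <= Cmod (1 - u))%R.
Proof.
generalize (Cmod_triangle (1 - u) u); replace (1 - u + u) with (RtoC 1) by ring.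
rewrite Cmod_1; lra.
Qed.

(** * Uniform convergence and infinite q-shifted factorials *)

Definition bdd {X : Type} (S : X -> Prop) (g : X -> C) : Prop :=
  exists M : R, forall x, S x -> (Cmod (g x) <= M)%R.

Definition ucv {X : Type} (S : X -> Prop) (f : nat -> X -> C) (g : X -> C) : Prop :=
  forall eps : R, (0 < eps)%R -> exists N, forall n x, (N <= n)%nat -> S x ->
    (Cmod (f n x - g x) < eps)%R.

Lemma bdd_pos {X : Type} (S : X -> Prop) (g : X -> C) :
  bdd S g -> exists M : R, (0 < M)%R /\ forall x, S x -> (Cmod (g x) <= M)%R.
Proof.
intros [M H]; exists (Rabs M + 1)%R; split.
- generalize (Rabs_pos M); lra.
- intros x Hx; generalize (H x Hx) (Rle_abs M); lra.
Qed.

Lemma bdd_mult {X : Type} (S : X -> Prop) (f g : X -> C) :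
  bdd S f -> bdd S g -> bdd S (fun x => f x * g x).
Proof.
intros [M HM] [L HL]; exists (M * L)%R; intros x Hx; rewrite Cmod_mult.
apply Rmult_le_compat; auto using Cmod_ge_0.
Qed.

Lemma bdd_plus {X : Type} (S : X -> Prop) (f g : X -> C) :
  bdd S f -> bdd S g -> bdd S (fun x => f x + g x).
Proof.
intros [M HM] [L HL]; exists (M + L)%R; intros x Hx.
eapply Rle_trans; [apply Cmod_triangle|]; apply Rplus_le_compat; auto.
Qed.

Lemma bdd_const {X : Type} (S : X -> Prop) (c : C) : bdd S (fun _ => c).
Proof. exists (Cmod c); intros; lra. Qed.

Lemma bdd_inv {X : Type} (S : X -> Prop) (g : X -> C) (m : R) :
  (0 < m)%R -> (forall x, S x -> (m <= Cmod (g x))%R) -> bdd S (fun x => / g x).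
Proof.
intros Hm H; exists (/ m)%R; intros x Hx; specialize (H x Hx).
rewrite Cmod_inv by (apply Cmod_gt_0; lra).
apply Rinv_le_contravar; easy.
Qed.

Lemma ucv_ext {X : Type} (S : X -> Prop) (f f' : nat -> X -> C) (g g' : X -> C) :
  (forall n x, S x -> f n x = f' n x) -> (forall x, S x -> g x = g' x) ->
  ucv S f g -> ucv S f' g'.
Proof.
intros Hf Hg H eps He; destruct (H eps He) as [N HN]; exists N; intros n x Hn Hx.
rewrite <- Hf, <- Hg by easy; auto.
Qed.

Lemma ucv_const {X : Type} (S : X -> Prop) (g : X -> C) : ucv S (fun _ => g) g.
Proof.
intros eps He; exists O; intros; replace (g x - g x) with (RtoC 0) by ring.
rewrite Cmod_0; easy.
Qed.

Lemma ucv_mult {X : Type} (S : X -> Prop) (f f' : nat -> X -> C) (g g' : X -> C) :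
  bdd S g -> bdd S g' -> ucv S f g -> ucv S f' g' ->
  ucv S (fun n x => f n x * f' n x) (fun x => g x * g' x).
Proof.
intros [M [HM0 HM]]%bdd_pos [L [HL0 HL]]%bdd_pos Hf Hf' eps He.
destruct (Hf (Rmin 1 (eps / (2 * (L + 1))))%R) as [N1 H1].
{ apply Rmin_pos; [lra|]; apply Rdiv_lt_0_compat; lra. }
destruct (Hf' (Rmin 1 (eps / (2 * M)))%R) as [N2 H2].
{ apply Rmin_pos; [lra|]; apply Rdiv_lt_0_compat; lra. }
exists (Nat.max N1 N2); intros n x Hn Hx.
specialize (H1 n x ltac:(lia) Hx); specialize (H2 n x ltac:(lia) Hx).
specialize (HM x Hx); specialize (HL x Hx).
replace (f n x * f' n x - g x * g' x)
  with ((f n x - g x) * (g' x + (f' n x - g' x)) + g x * (f' n x - g' x)) by ring.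
eapply Rle_lt_trans; [apply Cmod_triangle|]; rewrite !Cmod_mult.
assert (A1 : (Cmod (g' x + (f' n x - g' x)) <= L + 1)%R).
{ eapply Rle_trans; [apply Cmod_triangle|].
  generalize (Rmin_l 1 (eps / (2 * M))); lra. }
assert (B1 : (Cmod (f n x - g x) * (L + 1) < eps / 2)%R).
{ replace (eps / 2)%R with (eps / (2 * (L + 1)) * (L + 1))%R by (field; lra).
  apply Rmult_lt_compat_r; [lra|].
  eapply Rlt_le_trans; [apply H1|apply Rmin_r]. }
assert (B2 : (M * Cmod (f' n x - g' x) < eps / 2)%R).
{ replace (eps / 2)%R with (M * (eps / (2 * M)))%R by (field; lra).
  apply Rmult_lt_compat_l; [lra|].
  eapply Rlt_le_trans; [apply H2|apply Rmin_r]. }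
generalize (Cmod_ge_0 (f n x - g x)) (Cmod_ge_0 (f' n x - g' x)); intros.
generalize (Rmult_le_compat_l _ _ _ H A1); intros.
generalize (Rmult_le_compat_r _ _ _ H0 HM); intros; lra.
Qed.

Lemma ucv_inv {X : Type} (S : X -> Prop) (f : nat -> X -> C) (g : X -> C) (m : R) :
  (0 < m)%R -> (forall x, S x -> (m <= Cmod (g x))%R) ->
  ucv S f g -> ucv S (fun n x => / f n x) (fun x => / g x).
Proof.
intros Hm Hg Hf eps He.
destruct (Hf (Rmin (m / 2) (eps * (m * m) / 2))%R) as [N HN].
{ apply Rmin_pos; [lra|]; apply Rdiv_lt_0_compat; [|lra].
  apply Rmult_lt_0_compat; [easy|nra]. }
exists N; intros n x Hn Hx; specialize (HN n x Hn Hx); specialize (Hg x Hx).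
assert (H1 : (m / 2 <= Cmod (f n x))%R).
{ generalize (Cmod_triangle (f n x) (g x - f n x)).
  replace (f n x + (g x - f n x)) with (g x) by ring.
  rewrite Cmod_minus_sym in HN; generalize (Rmin_l (m / 2) (eps * (m * m) / 2)); lra. }
assert (Hf0 : f n x <> 0) by (apply Cmod_gt_0; lra).
assert (Hg0 : g x <> 0) by (apply Cmod_gt_0; lra).
replace (/ f n x - / g x) with ((g x - f n x) / (f n x * g x)) by (field; easy).
rewrite Cmod_div by (apply Cmult_neq_0; easy).
rewrite Cmod_minus_sym, Cmod_mult.
assert (H2 : (m / 2 * m <= Cmod (f n x) * Cmod (g x))%R)
  by (apply Rmult_le_compat; lra).
assert (H3 : (0 < m / 2 * m)%R) by nra.
apply Rmult_lt_reg_r with (Cmod (f n x) * Cmod (g x))%R; [lra|].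
unfold Rdiv at 1; rewrite Rmult_assoc, Rinv_l, Rmult_1_r by lra.
eapply Rlt_le_trans; [exact HN|].
eapply Rle_trans; [apply Rmin_r|].
replace (eps * (m * m) / 2)%R with (eps * (m / 2 * m))%R by field.
apply Rmult_le_compat_l; lra.
Qed.

Definition cseq (u : nat -> C) (l : C) : Prop :=
  ucv (fun _ : unit => True) (fun n _ => u n) (fun _ => l).

Lemma cseq_at {X : Type} (S : X -> Prop) (f : nat -> X -> C) (g : X -> C) (x : X) :
  ucv S f g -> S x -> cseq (fun n => f n x) (g x).
Proof.
intros H Hx eps He; destruct (H eps He) as [N HN]; exists N; intros; auto.
Qed.

Lemma cseq_CLim_seq (u : nat -> C) (l : C) : cseq u l -> CLim_seq u = l.
Proof.
intros H; unfold CLim_seq.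
assert (Hre : is_lim_seq (fun n => Re (u n)) (Re l)).
{ apply is_lim_seq_spec; intros eps; destruct (H eps (cond_pos eps)) as [N HN].
  exists N; intros n Hn; eapply Rle_lt_trans; [|apply (HN n tt Hn I)].
  rewrite <- Re_minus; apply re_le_Cmod. }
assert (Him : is_lim_seq (fun n => Im (u n)) (Im l)).
{ apply is_lim_seq_spec; intros eps; destruct (H eps (cond_pos eps)) as [N HN].
  exists N; intros n Hn; eapply Rle_lt_trans; [|apply (HN n tt Hn I)].
  rewrite <- Im_minus; apply im_le_Cmod. }
rewrite (is_lim_seq_unique _ _ Hre), (is_lim_seq_unique _ _ Him).
now destruct l.
Qed.

Lemma cseq_unique (u : nat -> C) (l l' : C) : cseq u l -> cseq u l' -> l = l'.
Proof.
intros H H'; rewrite <- (cseq_CLim_seq u l H); apply cseq_CLim_seq, H'.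
Qed.

Lemma cseq_cauchy (u : nat -> C) (e : nat -> R) :
  is_lim_seq e 0 ->
  (forall n m, (Cmod (u (n + m)%nat - u n) <= e n)%R) ->
  forall n, (Cmod (u n - CLim_seq u) <= 2 * e n)%R.
Proof.
intros He Hu.
assert (Hc : forall g : C -> R, (forall v w, Rabs (g v - g w) <= Cmod (v - w))%R ->
   is_lim_seq (fun n => g (u n)) (real (Lim_seq (fun n => g (u n))))).
{ intros g Hg; apply Lim_seq_correct', ex_lim_seq_cauchy_corr.
  intros eps; apply is_lim_seq_spec in He.
  destruct (He (pos_div_2 eps)) as [N HN]; exists N; intros n m Hn Hm.
  assert (HN' := HN N ltac:(lia)); simpl in HN'.
  rewrite Rminus_0_r in HN'; generalize (Rle_abs (e N)); intros.
  replace (g (u n) - g (u m))%R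
    with ((g (u n) - g (u N)) - (g (u m) - g (u N)))%R by ring.
  eapply Rle_lt_trans; [apply Rabs_triang|]; rewrite Rabs_Ropp.
  generalize (Hg (u n) (u N)) (Hg (u m) (u N)) (Hu N (n - N)%nat) (Hu N (m - N)%nat).
  replace (N + (n - N))%nat with n by lia; replace (N + (m - N))%nat with m by lia.
  lra. }
assert (Hb : forall (g : C -> R) n, (forall v w, Rabs (g v - g w) <= Cmod (v - w))%R ->
  (Rabs (g (u n) - real (Lim_seq (fun n => g (u n)))) <= e n)%R).
{ intros g n Hg; specialize (Hc g Hg).
  assert (H1 : is_lim_seq (fun m => Rabs (g (u n) - g (u (n + m)%nat)))
     (Rabs (g (u n) - real (Lim_seq (fun n => g (u n)))))).
  { apply (is_lim_seq_abs _ (Finite _)), is_lim_seq_minus'; [apply is_lim_seq_const|].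
    apply is_lim_seq_incr_n with (N := n) in Hc.
    eapply is_lim_seq_ext; [|exact Hc]; intros m; simpl; now rewrite Nat.add_comm. }
  apply (is_lim_seq_le _ (fun _ => e n) _ _) with (2 := H1) (3 := is_lim_seq_const _).
  intros m; eapply Rle_trans; [apply Hg|]; rewrite Cmod_minus_sym; apply Hu. }
intros n; eapply Rle_trans; [apply Cmod_le_Rabs_plus|].
rewrite Re_minus, Im_minus; unfold CLim_seq.
assert (H1 := Hb Re n ltac:(intros; rewrite <- Re_minus; apply re_le_Cmod)).
assert (H2 := Hb Im n ltac:(intros; rewrite <- Im_minus; apply im_le_Cmod)).
simpl in *; lra.
Qed.

Definition geo (q : R) (n : nat) : R := ((1 - q ^ n) / (1 - q))%R.

Lemma geo_S (q : R) (n : nat) : (0 < q < 1)%R -> geo q (S n) = (geo q n + q ^ n)%R.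
Proof. intros H; unfold geo; simpl; field; lra. Qed.

Lemma geo_bounds (q : R) (n : nat) : (0 < q < 1)%R -> (0 <= geo q n <= / (1 - q))%R.
Proof.
intros H; unfold geo, Rdiv; generalize (pow_le_1 q n H); intros Hn.
assert (0 < / (1 - q))%R by (apply Rinv_0_lt_compat; lra); nra.
Qed.

Lemma exp_ge (x : R) : (1 + x <= exp x)%R.
Proof.
destruct (Req_dec x 0) as [->|H]; [rewrite exp_0; lra|].
left; apply exp_ineq1; easy.
Qed.

Lemma exp_le (x y : R) : (x <= y)%R -> (exp x <= exp y)%R.
Proof. intros [H| ->]; [left; apply exp_increasing, H|lra]. Qed.

Lemma qpoch_bound (a : C) (q : R) (r : R) (n : nat) :
  (0 < q < 1)%R -> (Cmod a <= r)%R -> (Cmod (qpoch a q n) <= exp (r * geo q n))%R.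
Proof.
intros Hq Ha; assert (H0 := Cmod_ge_0 a); induction n as [|n IH].
- simpl; rewrite Cmod_1; unfold geo; simpl.
  replace (r * ((1 - 1) / (1 - q)))%R with 0%R by (field; lra); rewrite exp_0; lra.
- cbn [qpoch]; rewrite Cmod_mult, geo_S, Rmult_plus_distr_l, exp_plus by easy.
  apply Rmult_le_compat; try apply Cmod_ge_0; [easy|].
  eapply Rle_trans; [|apply exp_ge].
  unfold Cminus; eapply Rle_trans; [apply Cmod_triangle|].
  rewrite Cmod_1, Cmod_opp, Cmod_mult, Cmod_pow, Cmod_q by easy.
  generalize (pow_le_1 q n Hq); nra.
Qed.

Lemma qpoch_bound_unif (a : C) (q : R) (r : R) (n : nat) :
  (0 < q < 1)%R -> (Cmod a <= r)%R -> (Cmod (qpoch a q n) <= exp (r / (1 - q)))%R.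
Proof.
intros Hq Ha; eapply Rle_trans; [apply qpoch_bound; eauto|apply exp_le].
apply Rmult_le_compat_l; [generalize (Cmod_ge_0 a); lra|apply geo_bounds, Hq].
Qed.

Lemma qpoch_lipschitz (a b : C) (q : R) (r : R) (n : nat) :
  (0 < q < 1)%R -> (Cmod a <= r)%R -> (Cmod b <= r)%R ->
  (Cmod (qpoch a q n - qpoch b q n) <= exp (r * geo q n) * geo q n * Cmod (a - b))%R.
Proof.
intros Hq Ha Hb; assert (H0 := Cmod_ge_0 a); induction n as [|n IH].
- simpl; replace (1 - 1) with (RtoC 0) by ring; rewrite Cmod_0.
  unfold geo; simpl; replace ((1 - 1) / (1 - q))%R with 0%R by (field; lra); lra.
- cbn [qpoch].
  replace (qpoch a q n * (1 - a * q ^ n) - qpoch b q n * (1 - b * q ^ n))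
   with ((qpoch a q n - qpoch b q n) * (1 - a * q ^ n)
          + qpoch b q n * (q ^ n * (b - a))) by ring.
  eapply Rle_trans; [apply Cmod_triangle|].
  rewrite !Cmod_mult, Cmod_pow, Cmod_q, (Cmod_minus_sym b) by easy.
  rewrite geo_S, (Rmult_plus_distr_l r), exp_plus by easy.
  assert (Hn := pow_le_1 q n Hq); assert (Hg := geo_bounds q n Hq).
  assert (H1 : (Cmod (1 - a * q ^ n) <= exp (r * q ^ n))%R).
  { eapply Rle_trans; [|apply exp_ge].
    unfold Cminus; eapply Rle_trans; [apply Cmod_triangle|].
    rewrite Cmod_1, Cmod_opp, Cmod_mult, Cmod_pow, Cmod_q by easy; nra. }
  assert (H2 := qpoch_bound b q r n Hq Hb).
  assert (H3 : (1 <= exp (r * q ^ n))%R).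
  { eapply Rle_trans; [|apply exp_ge]; nra. }
  assert (Hd := Cmod_ge_0 (a - b)).
  set (D := Cmod (a - b)) in *; set (E := exp (r * geo q n)) in *.
  set (F := exp (r * q ^ n)) in *; set (g := geo q n) in *.
  assert (HE : (0 < E)%R) by apply exp_pos.
  apply Rle_trans with (E * g * D * F + E * (q ^ n * D))%R.
  + apply Rplus_le_compat.
    * apply Rmult_le_compat; auto using Cmod_ge_0.
    * apply Rmult_le_compat_r; [nra|easy].
  + assert (E * (q ^ n * D) * 1 <= E * (q ^ n * D) * F)%R; [|nra].
    apply Rmult_le_compat_l; [|easy].
    apply Rmult_le_pos; [lra|nra].
Qed.

Lemma qpoch_cauchy (a : C) (q : R) (r : R) (n m : nat) :
  (0 < q < 1)%R -> (Cmod a <= r)%R ->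
  (Cmod (qpoch a q (n + m) - qpoch a q n)
   <= exp (r / (1 - q)) * r / (1 - q) * q ^ n)%R.
Proof.
intros Hq Ha; assert (H0 := Cmod_ge_0 a); set (K := exp (r / (1 - q))).
assert (HK : (0 < K)%R) by apply exp_pos.
assert (Hn := pow_le_1 q n Hq).
assert (H : (Cmod (qpoch a q (n + m) - qpoch a q n) <= K * r * q ^ n * geo q m)%R).
{ induction m as [|m IH].
  - rewrite Nat.add_0_r; replace (_ - _) with (RtoC 0) by ring.
    rewrite Cmod_0; unfold geo; simpl.
    replace ((1 - 1) / (1 - q))%R with 0%R by (field; lra); lra.
  - rewrite Nat.add_succ_r; eapply Rle_trans; [apply (Cmod_triangle3 _ (qpoch a q (n + m)))|].
    rewrite geo_S, Rmult_plus_distr_l, Rplus_comm by easy; apply Rplus_le_compat; [easy|].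
    cbn [qpoch].
    replace (_ * (1 - _) - _) with (- (qpoch a q (n + m) * (a * q ^ (n + m)))) by ring.
    rewrite Cmod_opp, !Cmod_mult, Cmod_pow, Cmod_q, pow_add by easy.
    assert (Hm := pow_le_1 q m Hq).
    replace (K * r * q ^ n * q ^ m)%R with (K * (r * (q ^ n * q ^ m)))%R by ring.
    apply Rmult_le_compat; [apply Cmod_ge_0| |apply qpoch_bound_unif; easy|].
    + apply Rmult_le_pos; [easy|nra].
    + apply Rmult_le_compat_r; [nra|easy]. }
eapply Rle_trans; [exact H|].
replace (K * r / (1 - q) * q ^ n)%R with (K * r * q ^ n * / (1 - q))%R by (field; lra).
apply Rmult_le_compat_l; [|apply geo_bounds, Hq].
apply Rmult_le_pos; [apply Rmult_le_pos|]; lra.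
Qed.

Lemma qpoch_inf_approx (a : C) (q : R) (r : R) (n : nat) :
  (0 < q < 1)%R -> (Cmod a <= r)%R ->
  (Cmod (qpoch a q n - qpoch_inf a q)
   <= 2 * (exp (r / (1 - q)) * r / (1 - q) * q ^ n))%R.
Proof.
intros Hq Ha; apply (cseq_cauchy _ (fun n => exp (r / (1 - q)) * r / (1 - q) * q ^ n)%R).
- replace (Finite 0) with (Rbar_mult (exp (r / (1 - q)) * r / (1 - q))%R 0)
    by (simpl; f_equal; ring).
  apply is_lim_seq_scal_l, is_lim_seq_geom; rewrite Rabs_pos_eq; lra.
- intros; apply qpoch_cauchy; easy.
Qed.

Lemma pow_lt_eps (q K eps : R) : (0 < q < 1)%R -> (0 < eps)%R ->
  exists N, forall n, (N <= n)%nat -> (K * q ^ n < eps)%R.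
Proof.
intros Hq He.
assert (H : is_lim_seq (fun n => K * q ^ n)%R 0).
{ replace (Finite 0) with (Rbar_mult K 0) by (simpl; f_equal; ring).
  apply is_lim_seq_scal_l, is_lim_seq_geom; rewrite Rabs_pos_eq; lra. }
apply is_lim_seq_spec in H; destruct (H (mkposreal _ He)) as [N HN].
exists N; intros n Hn; specialize (HN n Hn); simpl in HN.
rewrite Rminus_0_r in HN; generalize (Rle_abs (K * q ^ n)); lra.
Qed.

Lemma qpoch_ucv {X : Type} (S : X -> Prop) (u : X -> C) (q : R) :
  (0 < q < 1)%R -> bdd S u ->
  ucv S (fun n x => qpoch (u x) q n) (fun x => qpoch_inf (u x) q).
Proof.
intros Hq [r Hr] eps He.
destruct (pow_lt_eps q (2 * (exp (r / (1 - q)) * r / (1 - q))) eps Hq He) as [N HN].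
exists N; intros n x Hn Hx; specialize (HN n Hn).
eapply Rle_lt_trans; [apply qpoch_inf_approx; eauto|lra].
Qed.

Lemma qpoch_cseq (a : C) (q : R) : (0 < q < 1)%R -> cseq (qpoch a q) (qpoch_inf a q).
Proof.
intros Hq; apply (cseq_at (fun _ : unit => True) (fun n _ => qpoch a q n)
  (fun _ => qpoch_inf a q) tt); [|easy].
apply (qpoch_ucv _ (fun _ => a)); [easy|apply bdd_const].
Qed.

Lemma cseq_Cmod_le (u : nat -> C) (l : C) (M : R) :
  cseq u l -> (forall n, (Cmod (u n) <= M)%R) -> (Cmod l <= M)%R.
Proof.
intros H HM; apply Rnot_lt_le; intros Hlt.
destruct (H (Cmod l - M)%R ltac:(lra)) as [N HN].
specialize (HN N tt ltac:(lia) I); specialize (HM N); simpl in HN.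
generalize (Cmod_triangle (u N) (l - u N)); rewrite (Cmod_minus_sym l).
replace (u N + (l - u N)) with l by ring; lra.
Qed.

Lemma cseq_plus_scal (u v : nat -> C) (l m c : C) :
  cseq u l -> cseq v m -> cseq (fun n => u n + c * v n) (l + c * m).
Proof.
intros Hu Hv eps He.
assert (Hc := Cmod_ge_0 c).
destruct (Hu (eps / 2)%R ltac:(lra)) as [N1 H1].
destruct (Hv (eps / 2 / (Cmod c + 1))%R) as [N2 H2].
{ apply Rdiv_lt_0_compat; lra. }
exists (Nat.max N1 N2); intros n x Hn Hx.
specialize (H1 n x ltac:(lia) Hx); specialize (H2 n x ltac:(lia) Hx).
replace (u n + c * v n - (l + c * m)) with ((u n - l) + c * (v n - m)) by ring.
eapply Rle_lt_trans; [apply Cmod_triangle|]; rewrite Cmod_mult.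
assert (Cmod (v n - m) * (Cmod c + 1) < eps / 2)%R.
{ replace (eps / 2)%R with (eps / 2 / (Cmod c + 1) * (Cmod c + 1))%R by (field; lra).
  apply Rmult_lt_compat_r; lra. }
generalize (Cmod_ge_0 (v n - m)); lra.
Qed.

Lemma qpoch_inf_lipschitz (a b : C) (q : R) (r : R) :
  (0 < q < 1)%R -> (Cmod a <= r)%R -> (Cmod b <= r)%R ->
  (Cmod (qpoch_inf a q - qpoch_inf b q)
    <= exp (r / (1 - q)) / (1 - q) * Cmod (a - b))%R.
Proof.
intros Hq Ha Hb.
replace (qpoch_inf a q - qpoch_inf b q)
  with (qpoch_inf a q + - (1) * qpoch_inf b q) by ring.
eapply cseq_Cmod_le; [apply cseq_plus_scal; apply qpoch_cseq; easy|].
intros n; simpl; replace (_ + _) with (qpoch a q n - qpoch b q n) by ring.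
eapply Rle_trans; [apply (qpoch_lipschitz a b q r); easy|].
apply Rmult_le_compat_r; [apply Cmod_ge_0|].
assert (Hg := geo_bounds q n Hq); assert (H0 := Cmod_ge_0 a).
apply Rmult_le_compat; [left; apply exp_pos|easy| |easy].
apply exp_le, Rmult_le_compat_l; lra.
Qed.

Lemma qpoch_inf_shift (a : C) (q : R) (n : nat) :
  (0 < q < 1)%R -> qpoch_inf a q = qpoch a q n * qpoch_inf (a * q ^ n) q.
Proof.
intros Hq.
apply (cseq_unique (fun m => qpoch a q (n + m))).
- intros eps He; destruct (qpoch_cseq a q Hq eps He) as [N HN].
  exists N; intros m x Hm Hx; exact (HN (n + m)%nat x ltac:(lia) Hx).
- eapply ucv_ext; [| |apply (ucv_mult _ (fun _ _ => qpoch a q n)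
      (fun m (_ : unit) => qpoch (a * q ^ n) q m) (fun _ => qpoch a q n))].
  + intros m x _; simpl; symmetry; apply qpoch_add.
  + intros x _; reflexivity.
  + apply bdd_const.
  + apply bdd_const.
  + apply ucv_const.
  + apply qpoch_cseq, Hq.
Qed.

Lemma qpoch_inf_0 (q : R) : qpoch_inf 0 q = 1.
Proof.
apply cseq_CLim_seq; intros eps He; exists O; intros n x _ _.
replace (qpoch 0 q n) with (RtoC 1).
- replace (1 - 1) with (RtoC 0) by ring; rewrite Cmod_0; easy.
- induction n as [|n IH]; [easy|]; cbn [qpoch]; rewrite <- IH; ring.
Qed.

Lemma qpoch_lower (a : C) (q : R) (r : R) (n : nat) :
  (0 < q < 1)%R -> (r < 1)%R -> (Cmod a <= r)%R ->
  (exp (- (r / (1 - r) / (1 - q))) <= Cmod (qpoch a q n))%R.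
Proof.
intros Hq Hr Ha; assert (H0 := Cmod_ge_0 a).
assert (Hs : (0 <= r / (1 - r))%R).
{ apply Rmult_le_pos; [lra|left; apply Rinv_0_lt_compat; lra]. }
apply Rle_trans with (exp (- (r / (1 - r) * geo q n))).
{ apply exp_le, Ropp_le_contravar, Rmult_le_compat_l; [easy|apply geo_bounds, Hq]. }
induction n as [|n IH].
- simpl; rewrite Cmod_1; unfold geo; simpl.
  replace (- (r / (1 - r) * ((1 - 1) / (1 - q))))%R with 0%R by (field; lra).
  rewrite exp_0; lra.
- cbn [qpoch]; rewrite Cmod_mult, geo_S by easy.
  rewrite Rmult_plus_distr_l, Ropp_plus_distr, exp_plus.
  apply Rmult_le_compat; try (left; apply exp_pos); [easy|].
  assert (Hn := pow_le_1 q n Hq).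
  eapply Rle_trans; [|apply Cmod_one_minus_le].
  rewrite Cmod_mult, Cmod_pow, Cmod_q by easy.
  apply Rle_trans with (1 - r * q ^ n)%R; [|nra].
  rewrite exp_Ropp.
  assert (Hp : (0 <= r / (1 - r) * q ^ n)%R) by (apply Rmult_le_pos; lra).
  apply Rle_trans with (/ (1 + r / (1 - r) * q ^ n))%R.
  + apply Rinv_le_contravar; [lra|apply exp_ge].
  + apply Rmult_le_reg_l with (1 + r / (1 - r) * q ^ n)%R; [lra|].
    rewrite Rinv_r by lra.
    replace ((1 + r / (1 - r) * q ^ n) * (1 - r * q ^ n))%R
      with (1 + r * r / (1 - r) * (q ^ n * (1 - q ^ n)))%R by (field; lra).
    assert (0 <= r * r / (1 - r))%R.
    { apply Rmult_le_pos; [nra|left; apply Rinv_0_lt_compat; lra]. }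
    assert (0 <= r * r / (1 - r) * (q ^ n * (1 - q ^ n)))%R; [|lra].
    apply Rmult_le_pos; [easy|nra].
Qed.

Lemma qpoch_inf_lower (a : C) (q : R) (r : R) :
  (0 < q < 1)%R -> (r < 1)%R -> (Cmod a <= r)%R ->
  (exp (- (r / (1 - r) / (1 - q))) <= Cmod (qpoch_inf a q))%R.
Proof.
intros Hq Hr Ha; set (m := exp _).
apply Rnot_lt_le; intros Hlt.
destruct (qpoch_cseq a q Hq (m - Cmod (qpoch_inf a q))%R ltac:(lra)) as [N HN].
specialize (HN N tt ltac:(lia) I); simpl in HN.
generalize (qpoch_lower a q r N Hq Hr Ha); fold m; intros.
generalize (Cmod_triangle (qpoch a q N - qpoch_inf a q) (qpoch_inf a q)).
replace (qpoch a q N - qpoch_inf a q + qpoch_inf a q) with (qpoch a q N) by ring; lra.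
Qed.

Lemma qpoch_inf_neq_0 (a : C) (q : R) :
  (0 < q < 1)%R -> (Cmod a < 1)%R -> qpoch_inf a q <> 0.
Proof.
intros Hq Ha; apply Cmod_gt_0.
eapply Rlt_le_trans; [apply exp_pos|].
apply (qpoch_inf_lower a q (Cmod a)); [easy|easy|apply Rle_refl].
Qed.

Lemma qpoch_inf_bound (a : C) (q : R) (r : R) :
  (0 < q < 1)%R -> (Cmod a <= r)%R -> (Cmod (qpoch_inf a q) <= exp (r / (1 - q)))%R.
Proof.
intros Hq Ha; eapply cseq_Cmod_le; [apply qpoch_cseq, Hq|].
intros n; apply qpoch_bound_unif; easy.
Qed.

(** * Complex integrals over real intervals *)

Definition is_CInt (f : R -> C) (a b : R) (l : C) : Prop :=
  is_RInt (V := C_R_NormedModule) f a b l.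

Lemma is_CInt_pair (f : R -> C) (a b : R) (l : C) :
  is_RInt (fun t => Re (f t)) a b (Re l) -> is_RInt (fun t => Im (f t)) a b (Im l) ->
  is_CInt f a b l.
Proof.
intros H1 H2; destruct l as [u v].
apply (is_RInt_fct_extend_pair (U := R_NormedModule) (V := R_NormedModule) f); easy.
Qed.

Lemma is_CInt_Re (f : R -> C) (a b : R) (l : C) :
  is_CInt f a b l -> is_RInt (fun t => Re (f t)) a b (Re l).
Proof. apply (is_RInt_fct_extend_fst (U := R_NormedModule) (V := R_NormedModule) f). Qed.

Lemma is_CInt_Im (f : R -> C) (a b : R) (l : C) :
  is_CInt f a b l -> is_RInt (fun t => Im (f t)) a b (Im l).
Proof. apply (is_RInt_fct_extend_snd (U := R_NormedModule) (V := R_NormedModule) f). Qed.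

Lemma is_CInt_unique (f : R -> C) (a b : R) (l l' : C) :
  is_CInt f a b l -> is_CInt f a b l' -> l = l'.
Proof.
intros H H'.
rewrite <- (is_RInt_unique (V := C_R_CompleteNormedModule) f a b l H).
apply (is_RInt_unique (V := C_R_CompleteNormedModule) f a b l' H').
Qed.

Lemma is_CInt_ext (f g : R -> C) (a b : R) (l : C) :
  (forall x, (Rmin a b < x < Rmax a b)%R -> f x = g x) -> is_CInt f a b l -> is_CInt g a b l.
Proof. apply (is_RInt_ext (V := C_R_NormedModule)). Qed.

Lemma is_CInt_plus (f g : R -> C) (a b : R) (l m : C) :
  is_CInt f a b l -> is_CInt g a b m -> is_CInt (fun t => f t + g t) a b (l + m).
Proof. apply (is_RInt_plus (V := C_R_NormedModule)). Qed.

Lemma is_CInt_scal (c : C) (f : R -> C) (a b : R) (l : C) :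
  is_CInt f a b l -> is_CInt (fun t => c * f t) a b (c * l).
Proof.
intros H; apply is_CInt_pair.
- apply (is_RInt_ext (fun t => minus (scal (Re c) (Re (f t))) (scal (Im c) (Im (f t))))).
  + intros t _; reflexivity.
  + apply (is_RInt_minus (V := R_NormedModule));
      apply (is_RInt_scal (V := R_NormedModule)); [apply is_CInt_Re|apply is_CInt_Im]; easy.
- apply (is_RInt_ext (fun t => plus (scal (Re c) (Im (f t))) (scal (Im c) (Re (f t))))).
  + intros t _; reflexivity.
  + apply (is_RInt_plus (V := R_NormedModule));
      apply (is_RInt_scal (V := R_NormedModule)); [apply is_CInt_Im|apply is_CInt_Re]; easy.
Qed.

Lemma is_CInt_const (c : C) (a b : R) : is_CInt (fun _ => c) a b (RtoC (b - a) * c).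
Proof.
replace (RtoC (b - a) * c) with (scal (V := C_R_NormedModule) (b - a)%R c).
- apply (is_RInt_const (V := C_R_NormedModule)).
- destruct c; unfold scal; simpl; unfold prod_scal, scal; simpl; unfold mult; simpl.
  unfold Cmult, RtoC; simpl; f_equal; ring.
Qed.

Lemma is_CInt_ucv (f : nat -> R -> C) (g : R -> C) (h : nat -> C) (a b : R) :
  (forall n, is_CInt (f n) a b (h n)) -> ucv (fun _ => True) f g ->
  exists l, is_CInt g a b l /\ cseq h l.
Proof.
intros Hf Hg.
destruct (filterlim_RInt (V := C_R_CompleteNormedModule) f a b eventually _ g h Hf)
  as [l [Hl Hi]].
- apply (filterlim_locally (U := fct_UniformSpace R (CompleteNormedModule.UniformSpace
    R_AbsRing C_R_CompleteNormedModule)) f g).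
  intros eps; destruct (Hg eps (cond_pos eps)) as [N HN]; exists N; intros n Hn t.
  specialize (HN n t Hn I); split.
  + eapply Rle_lt_trans; [apply (re_le_Cmod (f n t - g t))|easy].
  + eapply Rle_lt_trans; [apply (im_le_Cmod (f n t - g t))|easy].
- exists l; split; [easy|].
  intros eps He; assert (He2 : (0 < eps / 2)%R) by lra.
  apply (filterlim_locally (U := CompleteNormedModule.UniformSpace R_AbsRing
    C_R_CompleteNormedModule)) with (eps := mkposreal _ He2) in Hl.
  destruct Hl as [N HN]; exists N; intros n x Hn _.
  destruct (HN n Hn) as [H1 H2].
  eapply Rle_lt_trans; [apply Cmod_le_Rabs_plus|].
  replace eps with (eps / 2 + eps / 2)%R by field; apply Rplus_lt_compat; [exact H1|exact H2].
Qed.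

Definition ccont (f : R -> C) (x : R) : Prop :=
  continuity_pt (fun t => Re (f t)) x /\ continuity_pt (fun t => Im (f t)) x.

Lemma ccont_eps (f : R -> C) (x : R) :
  ccont f x <->
  forall eps : R, (0 < eps)%R -> exists d : R, (0 < d)%R /\
    forall y, (Rabs (y - x) < d)%R -> (Cmod (f y - f x) < eps)%R.
Proof.
split.
- intros [Hf Hg] eps He.
  destruct (Hf (eps / 2)%R ltac:(lra)) as [d1 [Hd1 H1]].
  destruct (Hg (eps / 2)%R ltac:(lra)) as [d2 [Hd2 H2]].
  exists (Rmin d1 d2); split; [apply Rmin_pos; lra|]; intros y Hy.
  assert (Hy1 := Rlt_le_trans _ _ _ Hy (Rmin_l _ _)).
  assert (Hy2 := Rlt_le_trans _ _ _ Hy (Rmin_r _ _)).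
  eapply Rle_lt_trans; [apply Cmod_le_Rabs_plus|].
  replace eps with (eps / 2 + eps / 2)%R by field.
  destruct (Req_dec x y) as [->|Hxy].
  + rewrite Re_minus, Im_minus, !Rminus_diag, Rabs_R0; lra.
  + apply Rplus_lt_compat.
    * apply (H1 y); split; [split; [easy|exact Hxy]|exact Hy1].
    * apply (H2 y); split; [split; [easy|exact Hxy]|exact Hy2].
- intros H; split; intros eps He; destruct (H eps He) as [d [Hd Hf]];
    exists d; split; try easy; intros y [_ Hy]; specialize (Hf y Hy).
  + eapply Rle_lt_trans; [apply (re_le_Cmod (f y - f x))|easy].
  + eapply Rle_lt_trans; [apply (im_le_Cmod (f y - f x))|easy].
Qed.

Lemma ccont_continuous (f : R -> C) (x : R) :
  ccont f x -> continuous (U := C_R_CompleteNormedModule) f x.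
Proof.
intros H; apply (filterlim_locally (U := CompleteNormedModule.UniformSpace R_AbsRing
  C_R_CompleteNormedModule)); intros eps.
destruct (proj1 (ccont_eps f x) H eps (cond_pos eps)) as [d [Hd Hf]].
exists (mkposreal d Hd); intros y Hy; specialize (Hf y Hy); split.
- eapply Rle_lt_trans; [apply (re_le_Cmod (f y - f x))|easy].
- eapply Rle_lt_trans; [apply (im_le_Cmod (f y - f x))|easy].
Qed.

Lemma ccont_ex_CInt (f : R -> C) (a b : R) :
  (forall x, (Rmin a b <= x <= Rmax a b)%R -> ccont f x) -> exists l, is_CInt f a b l.
Proof.
intros H; apply (ex_RInt_continuous (V := C_R_CompleteNormedModule) f).
intros x Hx; apply ccont_continuous; auto.
Qed.

Lemma ccont_ext (f g : R -> C) (x : R) :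
  (forall t, f t = g t) -> ccont f x -> ccont g x.
Proof.
intros H [H1 H2]; split.
- refine (continuity_pt_ext _ _ _ _ H1); intros t; now rewrite H.
- refine (continuity_pt_ext _ _ _ _ H2); intros t; now rewrite H.
Qed.

Lemma ccont_const (c : C) (x : R) : ccont (fun _ => c) x.
Proof. split; apply continuity_pt_const; intros ? ?; reflexivity. Qed.

Lemma ccont_mult (f g : R -> C) (x : R) :
  ccont f x -> ccont g x -> ccont (fun t => f t * g t) x.
Proof.
intros [H1 H2] [H3 H4]; split.
- apply continuity_pt_minus; apply continuity_pt_mult; easy.
- apply continuity_pt_plus; apply continuity_pt_mult; easy.
Qed.

Lemma ccont_minus (f g : R -> C) (x : R) :
  ccont f x -> ccont g x -> ccont (fun t => f t - g t) x.
Proof. intros [H1 H2] [H3 H4]; split; apply continuity_pt_minus; easy. Qed.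

Lemma ccont_inv (f : R -> C) (x : R) :
  f x <> 0 -> ccont f x -> ccont (fun t => / f t) x.
Proof.
intros H0 [H1 H2].
assert (Hd : (Re (f x) * Re (f x) + Im (f x) * Im (f x))%R <> 0%R).
{ intros E; apply H0; rewrite (surjective_pairing (f x)).
  unfold Re, Im in E; unfold RtoC; f_equal; nra. }
assert (Hc : continuity_pt
  (fun t => (Re (f t) * Re (f t) + Im (f t) * Im (f t)))%R x)
  by (apply continuity_pt_plus; apply continuity_pt_mult; easy).
split.
- apply (continuity_pt_ext
    (div_fct (fun t => Re (f t)) (fun t => Re (f t) * Re (f t) + Im (f t) * Im (f t))%R)).
  + intros t; unfold div_fct, Cinv, Re, Im; simpl; now rewrite !Rmult_1_r.
  + apply continuity_pt_div; easy.
- apply (continuity_pt_ext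
    (div_fct (fun t => - Im (f t))%R (fun t => Re (f t) * Re (f t) + Im (f t) * Im (f t))%R)).
  + intros t; unfold div_fct, Cinv, Re, Im; simpl; now rewrite !Rmult_1_r.
  + apply continuity_pt_div; try easy.
    apply (continuity_pt_opp (fun t => Im (f t))); easy.
Qed.

Lemma ccont_pow (f : R -> C) (n : nat) (x : R) :
  ccont f x -> ccont (fun t => f t ^ n) x.
Proof.
intros Hf; induction n as [|n IH]; simpl; [apply ccont_const|apply ccont_mult; easy].
Qed.

Lemma ccont_qpoch_inf (f : R -> C) (q : R) (x : R) :
  (0 < q < 1)%R -> ccont f x -> ccont (fun t => qpoch_inf (f t) q) x.
Proof.
intros Hq Hf'; apply ccont_eps; intros eps He; assert (Hf := proj1 (ccont_eps f x) Hf').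
destruct (Hf 1%R Rlt_0_1) as [d1 [Hd1 H1]].
set (r := (Cmod (f x) + 1)%R).
set (K := (exp (r / (1 - q)) / (1 - q))%R).
assert (HK : (0 < K)%R).
{ apply Rdiv_lt_0_compat; [apply exp_pos|lra]. }
destruct (Hf (eps / K)%R) as [d2 [Hd2 H2]]; [apply Rdiv_lt_0_compat; easy|].
exists (Rmin d1 d2); split; [apply Rmin_pos; lra|]; intros y Hy.
assert (Hy1 := Rlt_le_trans _ _ _ Hy (Rmin_l _ _)).
assert (Hy2 := Rlt_le_trans _ _ _ Hy (Rmin_r _ _)).
eapply Rle_lt_trans; [apply (qpoch_inf_lipschitz _ _ q r Hq)|].
{ specialize (H1 y Hy1); unfold r.
  replace (f y) with (f x + (f y - f x)) by ring.
  eapply Rle_trans; [apply Cmod_triangle|lra]. }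
{ unfold r; lra. }
fold K; specialize (H2 y Hy2).
replace eps with (K * (eps / K))%R by (field; lra).
apply Rmult_lt_compat_l; easy.
Qed.

(** * Contour shifts *)

Definition ez (t : R) : C := (cos t, sin t).

Lemma ez_add (s t : R) : ez s * ez t = ez (s + t).
Proof. unfold ez, Cmult; simpl; rewrite cos_plus, sin_plus; f_equal; ring. Qed.

Lemma Cmod_ez (t : R) : Cmod (ez t) = 1%R.
Proof.
unfold Cmod, ez; simpl; rewrite !Rmult_1_r.
assert (H := sin2_cos2 t); unfold Rsqr in H.
rewrite Rplus_comm, H; apply sqrt_1.
Qed.

Lemma ez_neq_0 (t : R) : ez t <> 0.
Proof. apply Cmod_gt_0; rewrite Cmod_ez; lra. Qed.

Lemma ez_inv (t : R) : / ez t = ez (- t).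
Proof.
apply (Cmult_cancel_l (ez t)); [apply ez_neq_0|].
rewrite Cinv_r, ez_add by apply ez_neq_0.
replace (t + - t)%R with 0%R by ring; unfold ez; rewrite cos_0, sin_0; easy.
Qed.

Lemma ez_pow (t : R) (n : nat) : ez t ^ n = ez (INR n * t).
Proof.
induction n as [|n IH].
- simpl; rewrite Rmult_0_l; unfold ez; rewrite cos_0, sin_0; easy.
- rewrite Cpow_S, IH, ez_add, S_INR; f_equal; ring.
Qed.

Lemma ccont_ez (t : R) : ccont ez t.
Proof. split; [apply continuity_cos|apply continuity_sin]. Qed.

Definition mon (i j : nat) (z : C) : C := z ^ i * / z ^ j.

Lemma mon_ez (i j : nat) (t : R) : mon i j (ez t) = ez ((INR i - INR j) * t).
Proof. unfold mon; rewrite !ez_pow, ez_inv, ez_add; f_equal; ring. Qed.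

Lemma mon_add (i j i' j' : nat) (z : C) :
  z <> 0 -> mon i j z * mon i' j' z = mon (i + i') (j + j') z.
Proof.
intros Hz; unfold mon; rewrite !Cpow_add_r; field; split; apply Cpow_nz; easy.
Qed.

Lemma mon_scal (i j : nat) (q z : C) :
  q <> 0 -> z <> 0 -> mon i j (q * z) = mon i j q * mon i j z.
Proof.
intros Hq Hz; unfold mon; rewrite !Cpow_mult_l; field; split; apply Cpow_nz; easy.
Qed.

Lemma is_CInt_mon (i j : nat) :
  is_CInt (fun t => mon i j (ez t)) (- PI) PI
    (if Nat.eq_dec i j then RtoC (2 * PI) else 0).
Proof.
destruct (Nat.eq_dec i j) as [->|Hij].
- apply (is_CInt_ext (fun _ => 1)).
  + intros t _; unfold mon; rewrite Cinv_r; [easy|apply Cpow_nz, ez_neq_0].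
  + replace (RtoC (2 * PI)) with (RtoC (PI - - PI) * 1).
    * apply is_CInt_const.
    * rewrite Cmult_1_r; f_equal; ring.
- set (k := (Z.of_nat i - Z.of_nat j)%Z).
  assert (Hk : (INR i - INR j)%R = IZR k)
    by (unfold k; rewrite minus_IZR, !INR_IZR_INZ; easy).
  assert (Hk0 : IZR k <> 0%R) by (apply not_0_IZR; unfold k; lia).
  assert (Hs : sin (IZR k * PI) = 0%R) by (apply sin_eq_0_1; exists k; easy).
  apply (is_CInt_ext (fun t => ez (IZR k * t))).
  { intros t _; rewrite mon_ez, Hk; easy. }
  apply is_CInt_pair; unfold ez; simpl.
  + replace 0%R with (minus (sin (IZR k * PI) / IZR k) (sin (IZR k * - PI) / IZR k))%R.
    * apply (is_RInt_derive (fun t => sin (IZR k * t) / IZR k)%R).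
      -- intros t _; auto_derive; [easy|field; easy].
      -- intros t _; apply continuity_pt_filterlim.
         apply derivable_continuous_pt; reg.
    * replace (IZR k * - PI)%R with (- (IZR k * PI))%R by ring.
      rewrite sin_neg, Hs; unfold minus, plus, opp; simpl; field; easy.
  + replace 0%R with (minus (- cos (IZR k * PI) / IZR k) (- cos (IZR k * - PI) / IZR k))%R.
    * apply (is_RInt_derive (fun t => - cos (IZR k * t) / IZR k)%R).
      -- intros t _; auto_derive; [easy|field; easy].
      -- intros t _; apply continuity_pt_filterlim.
         apply derivable_continuous_pt; reg.
    * replace (IZR k * - PI)%R with (- (IZR k * PI))%R by ring.
      rewrite cos_neg; unfold minus, plus, opp; simpl; field; easy.
Qed.

Definition two_circles (q : R) (z : C) : Prop := Cmod z = 1%R \/ Cmod z = q.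

(* Invariance under contour shift from [|z| = 1] to [|z| = q], required of all products
   with Laurent monomials so that the class is stable under the operations below. *)
Definition shift_inv (q : R) (g : C -> C) : Prop :=
  bdd (two_circles q) g /\
  forall i j : nat, exists l : C,
    is_CInt (fun t => mon i j (ez t) * g (ez t)) (- PI) PI l /\
    is_CInt (fun t => mon i j (q * ez t) * g (q * ez t)) (- PI) PI l.

Lemma two_circles_ez (q : R) (t : R) : (0 < q < 1)%R ->
  two_circles q (ez t) /\ two_circles q (q * ez t).
Proof.
intros Hq; split; [left; apply Cmod_ez|right].
rewrite Cmod_mult, Cmod_ez, Cmod_q by easy; ring.
Qed.

Lemma two_circles_neq_0 (q : R) (z : C) :
  (0 < q < 1)%R -> two_circles q z -> z <> 0.
Proof. intros Hq Hz; apply Cmod_gt_0; destruct Hz as [-> | ->]; lra. Qed.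

Lemma bdd_mon (q : R) (i j : nat) : (0 < q < 1)%R -> bdd (two_circles q) (mon i j).
Proof.
intros Hq.
assert (Hm : bdd (two_circles q) (fun z => / z ^ j)).
{ apply (bdd_inv _ _ (q ^ j)); [apply pow_lt; lra|].
  intros z Hz; rewrite Cmod_pow; apply pow_incr; destruct Hz as [-> | ->]; lra. }
apply bdd_mult; [|exact Hm].
exists 1%R; intros z Hz; rewrite Cmod_pow, <- (pow1 i); apply pow_incr.
split; [apply Cmod_ge_0|]; destruct Hz as [-> | ->]; lra.
Qed.

Lemma shift_inv_ext (q : R) (g h : C -> C) :
  (0 < q < 1)%R -> (forall z, two_circles q z -> g z = h z) ->
  shift_inv q g -> shift_inv q h.
Proof.
intros Hq He [[M HM] Hg]; split.
- exists M; intros z Hz; rewrite <- He by easy; auto.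
- intros i j; destruct (Hg i j) as [l [H1 H2]]; exists l; split.
  + refine (is_CInt_ext _ _ _ _ _ _ H1); intros t _; rewrite He; [easy|].
    apply two_circles_ez, Hq.
  + refine (is_CInt_ext _ _ _ _ _ _ H2); intros t _; rewrite He; [easy|].
    apply two_circles_ez, Hq.
Qed.

Lemma shift_inv_1 (q : R) : (0 < q < 1)%R -> shift_inv q (fun _ => 1).
Proof.
intros Hq; split; [apply bdd_const|]; intros i j.
exists (if Nat.eq_dec i j then RtoC (2 * PI) else 0); split.
- apply (is_CInt_ext (fun t => mon i j (ez t))); [intros; ring|apply is_CInt_mon].
- assert (Hq0 := Cq_neq_0 q Hq).
  apply (is_CInt_ext (fun t => mon i j q * mon i j (ez t))).
  + intros t _; rewrite mon_scal; [ring|easy|apply ez_neq_0].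
  + replace (if Nat.eq_dec i j then RtoC (2 * PI) else 0)
      with (mon i j q * (if Nat.eq_dec i j then RtoC (2 * PI) else 0)).
    * apply is_CInt_scal, is_CInt_mon.
    * destruct (Nat.eq_dec i j) as [->|_]; [|ring].
      unfold mon; rewrite Cinv_r; [ring|apply Cpow_nz; easy].
Qed.

Lemma shift_inv_lin (q : R) (g h : C -> C) (c : C) :
  shift_inv q g -> shift_inv q h -> shift_inv q (fun z => g z + c * h z).
Proof.
intros [Bg Hg] [Bh Hh]; split.
- apply bdd_plus; [easy|apply bdd_mult; [apply bdd_const|easy]].
- intros i j; destruct (Hg i j) as [l [H1 H2]]; destruct (Hh i j) as [m [H3 H4]].
  exists (l + c * m); split.
  + apply (is_CInt_ext (fun t => mon i j (ez t) * g (ez t)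
      + c * (mon i j (ez t) * h (ez t)))); [intros; ring|].
    apply is_CInt_plus; [easy|apply is_CInt_scal; easy].
  + apply (is_CInt_ext (fun t => mon i j (q * ez t) * g (q * ez t)
      + c * (mon i j (q * ez t) * h (q * ez t)))); [intros; ring|].
    apply is_CInt_plus; [easy|apply is_CInt_scal; easy].
Qed.

Lemma shift_inv_mon (q : R) (g : C -> C) (i j : nat) :
  (0 < q < 1)%R -> shift_inv q g -> shift_inv q (fun z => mon i j z * g z).
Proof.
intros Hq [Bg Hg]; split; [apply bdd_mult; [apply bdd_mon, Hq|easy]|].
intros i' j'; destruct (Hg (i' + i)%nat (j' + j)%nat) as [l [H1 H2]]; exists l; split.
- refine (is_CInt_ext _ _ _ _ _ _ H1); intros t _.
  rewrite <- mon_add by apply ez_neq_0; ring.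
- refine (is_CInt_ext _ _ _ _ _ _ H2); intros t _.
  rewrite <- mon_add; [ring|].
  apply Cmult_neq_0; [apply Cq_neq_0, Hq|apply ez_neq_0].
Qed.

Lemma shift_inv_ucv (q : R) (f : nat -> C -> C) (g : C -> C) :
  (0 < q < 1)%R -> (forall n, shift_inv q (f n)) -> bdd (two_circles q) g ->
  ucv (two_circles q) f g -> shift_inv q g.
Proof.
intros Hq Hf Bg Hfg; split; [easy|]; intros i j.
assert (H : forall u : R -> C, (forall t, two_circles q (u t)) ->
  ucv (fun _ => True) (fun n t => mon i j (u t) * f n (u t))
     (fun t => mon i j (u t) * g (u t))).
{ intros u Hu.
  assert (H : ucv (two_circles q) (fun n z => mon i j z * f n z) (fun z => mon i j z * g z)).
  { apply (ucv_mult _ (fun _ => mon i j)); try easy; [apply bdd_mon, Hq|apply ucv_const]. }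
  intros eps He; destruct (H eps He) as [N HN]; exists N; intros n t Hn _.
  apply HN; [easy|apply Hu]. }
set (h := fun n => RInt (V := C_R_CompleteNormedModule)
  (fun t => mon i j (ez t) * f n (ez t)) (- PI) PI).
assert (Hh : forall n,
    is_CInt (fun t => mon i j (ez t) * f n (ez t)) (- PI) PI (h n) /\
    is_CInt (fun t => mon i j (q * ez t) * f n (q * ez t)) (- PI) PI (h n)).
{ intros n; destruct (proj2 (Hf n) i j) as [l [H1 H2]].
  unfold h; rewrite (is_RInt_unique (V := C_R_CompleteNormedModule) _ _ _ l H1); easy. }
destruct (is_CInt_ucv _ _ h (- PI) PI (fun n => proj1 (Hh n))
  (H ez (fun t => proj1 (two_circles_ez q t Hq)))) as [l [H1 Hl]].
destruct (is_CInt_ucv _ _ h (- PI) PI (fun n => proj2 (Hh n))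
  (H (fun t => q * ez t) (fun t => proj2 (two_circles_ez q t Hq)))) as [l' [H2 Hl']].
exists l; split; [exact H1|].
rewrite (cseq_unique h l l' Hl Hl'); exact H2.
Qed.

Lemma shift_inv_geom (q : R) (g : C -> C) (c : C) (i j : nat) (r : R) :
  (0 < q < 1)%R -> (0 < r < 1)%R ->
  (forall z, two_circles q z -> (Cmod (c * mon i j z) <= r)%R) ->
  shift_inv q g -> shift_inv q (fun z => g z / (1 - c * mon i j z)).
Proof.
intros Hq Hr Hw Hg.
set (w := fun z => c * mon i j z) in *.
assert (Hd : forall z, two_circles q z -> (1 - r <= Cmod (1 - w z))%R).
{ intros z Hz; eapply Rle_trans; [|apply Cmod_one_minus_le].
  specialize (Hw z Hz); unfold w; lra. }
assert (Hwg : forall n, shift_inv q (fun z => w z ^ n * g z)).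
{ induction n as [|n IH].
  - refine (shift_inv_ext q _ _ Hq _ Hg); intros; simpl; ring.
  - refine (shift_inv_ext q _ _ Hq _
      (shift_inv_lin q _ _ (c - 1) (shift_inv_mon q _ i j Hq IH) (shift_inv_mon q _ i j Hq IH))).
    intros z Hz; unfold w; simpl; ring. }
apply (shift_inv_ucv q (fun n z => csum (fun l => w z ^ l) n * g z)); [easy| | |].
- induction n as [|n IH].
  + refine (shift_inv_ext q _ _ Hq _ (shift_inv_lin q _ _ (- (1)) Hg Hg)).
    intros; simpl; ring.
  + refine (shift_inv_ext q _ _ Hq _ (shift_inv_lin q _ _ 1 IH (Hwg n))).
    intros; simpl; ring.
- apply bdd_mult; [apply Hg|]; apply (bdd_inv _ _ (1 - r)); [lra|exact Hd].
- destruct Hg as [Bg _]; apply bdd_pos in Bg; destruct Bg as [M [HM0 HM]].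
  intros eps He.
  destruct (pow_lt_eps r (M / (1 - r)) eps Hr He) as [N HN]; exists N; intros n z Hn Hz.
  eapply Rle_lt_trans; [|apply (HN n Hn)].
  specialize (Hd z Hz); specialize (HM z Hz); specialize (Hw z Hz).
  assert (Hz0 : 1 - w z <> 0) by (apply Cmod_gt_0; lra).
  assert (Hs : csum (fun l => w z ^ l) n * (1 - w z) = 1 - w z ^ n).
  { clear; induction n as [|n IH]; simpl; [ring|].
    rewrite Cmult_plus_distr_r, IH; ring. }
  fold (w z).
  replace (csum (fun l => w z ^ l) n * g z - g z / (1 - w z))
    with (- (w z ^ n * g z / (1 - w z))).
  2:{ apply (Cmult_cancel_l (1 - w z)); [easy|].
      transitivity (csum (fun l => w z ^ l) n * (1 - w z) * g z - g z); [|field; easy].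
      rewrite Hs; field; easy. }
  rewrite Cmod_opp, Cmod_div, Cmod_mult, Cmod_pow by easy.
  replace (M / (1 - r) * r ^ n)%R with (r ^ n * M * / (1 - r))%R by (unfold Rdiv; ring).
  apply Rmult_le_compat.
  + apply Rmult_le_pos; [apply pow_le|]; apply Cmod_ge_0.
  + left; apply Rinv_0_lt_compat; lra.
  + apply Rmult_le_compat; [apply pow_le, Cmod_ge_0|apply Cmod_ge_0| |easy].
    apply pow_incr; split; [apply Cmod_ge_0|easy].
  + apply Rinv_le_contravar; lra.
Qed.

Lemma shift_inv_qpoch (q : R) (g : C -> C) (c : C) (i j n : nat) :
  (0 < q < 1)%R -> shift_inv q g ->
  shift_inv q (fun z => qpoch (c * mon i j z) q n * g z).
Proof.
intros Hq Hg; induction n as [|n IH].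
- refine (shift_inv_ext q _ _ Hq _ Hg); intros; simpl; ring.
- refine (shift_inv_ext q _ _ Hq _
    (shift_inv_lin q _ _ (- (c * q ^ n)) IH (shift_inv_mon q _ i j Hq IH))).
  intros z Hz; cbn [qpoch]; ring.
Qed.

Lemma shift_inv_qpoch_inv (q : R) (g : C -> C) (c : C) (i j : nat) (r : R) (n : nat) :
  (0 < q < 1)%R -> (0 < r < 1)%R ->
  (forall z, two_circles q z -> (Cmod (c * mon i j z) <= r)%R) ->
  shift_inv q g -> shift_inv q (fun z => g z / qpoch (c * mon i j z) q n).
Proof.
intros Hq Hr Hw Hg; induction n as [|n IH].
- refine (shift_inv_ext q _ _ Hq _ Hg); intros; simpl; field; apply C1_nz.
- refine (shift_inv_ext q _ _ Hq _
    (shift_inv_geom q _ (c * q ^ n) i j r Hq Hr _ IH)).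
  + intros z Hz; cbn [qpoch]; specialize (Hw z Hz).
    assert (H1 : qpoch (c * mon i j z) q (S n) <> 0) by (apply qpoch_neq_0; [easy|lra]).
    cbn [qpoch] in H1.
    assert (H2 : qpoch (c * mon i j z) q n <> 0) by (apply qpoch_neq_0; [easy|lra]).
    assert (H3 : 1 - c * mon i j z * q ^ n <> 0)
      by (intros E; apply H1; rewrite E; ring).
    field; repeat split; try easy; intros E; apply H3; rewrite <- E; ring.
  + intros z Hz; specialize (Hw z Hz).
    replace (c * q ^ n * mon i j z) with (c * mon i j z * q ^ n) by ring.
    eapply Rle_trans; [apply Cmod_qpow_mult, Hq|exact Hw].
Qed.

Lemma shift_inv_qpoch_inf (q : R) (g : C -> C) (c : C) (i j : nat) :
  (0 < q < 1)%R -> shift_inv q g ->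
  shift_inv q (fun z => qpoch_inf (c * mon i j z) q * g z).
Proof.
intros Hq Hg.
assert (Bw : bdd (two_circles q) (fun z => c * mon i j z)).
{ apply bdd_mult; [apply bdd_const|apply bdd_mon, Hq]. }
assert (Bp : bdd (two_circles q) (fun z => qpoch_inf (c * mon i j z) q)).
{ destruct Bw as [M HM]; exists (exp (M / (1 - q))); intros z Hz.
  apply qpoch_inf_bound; auto. }
apply (shift_inv_ucv q (fun n z => qpoch (c * mon i j z) q n * g z)); [easy| | |].
- intros n; apply shift_inv_qpoch; easy.
- apply bdd_mult; [easy|apply Hg].
- apply (ucv_mult _ (fun n z => qpoch (c * mon i j z) q n) (fun _ => g)
    (fun z => qpoch_inf (c * mon i j z) q)); [easy|apply Hg| |apply ucv_const].
  apply qpoch_ucv; easy.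
Qed.

Lemma shift_inv_qpoch_inf_inv (q : R) (g : C -> C) (c : C) (i j : nat) (r : R) :
  (0 < q < 1)%R -> (0 < r < 1)%R ->
  (forall z, two_circles q z -> (Cmod (c * mon i j z) <= r)%R) ->
  shift_inv q g -> shift_inv q (fun z => / qpoch_inf (c * mon i j z) q * g z).
Proof.
intros Hq Hr Hw Hg.
set (m := exp (- (r / (1 - r) / (1 - q)))).
assert (Hm : forall z, two_circles q z -> (m <= Cmod (qpoch_inf (c * mon i j z) q))%R).
{ intros z Hz; apply qpoch_inf_lower; [easy|lra|auto]. }
assert (Hm0 : (0 < m)%R) by apply exp_pos.
assert (Bp : bdd (two_circles q) (fun z => / qpoch_inf (c * mon i j z) q))
  by (apply (bdd_inv _ _ m); easy).
apply (shift_inv_ucv q (fun n z => / qpoch (c * mon i j z) q n * g z)); [easy| | |].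
- intros n; refine (shift_inv_ext q _ _ Hq _
    (shift_inv_qpoch_inv q g c i j r n Hq Hr Hw Hg)).
  intros z Hz; unfold Cdiv; ring.
- apply bdd_mult; [easy|apply Hg].
- apply (ucv_mult _ (fun n z => / qpoch (c * mon i j z) q n) (fun _ => g)
    (fun z => / qpoch_inf (c * mon i j z) q)); [easy|apply Hg| |apply ucv_const].
  apply (ucv_inv _ _ _ m); [easy|easy|].
  apply qpoch_ucv; [easy|]; exists r; easy.
Qed.

(** * The Askey--Wilson integral *)

Definition aw_circle (a b c d : C) (q : R) : C :=
  RInt (V := C_R_CompleteNormedModule) (fun t => aw_weight (ez t) a b c d q) (- PI) PI.

Lemma qpoch_inf_step (u : C) (q : R) :
  (0 < q < 1)%R -> qpoch_inf u q = (1 - u) * qpoch_inf (u * q) q.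
Proof.
intros Hq; rewrite (qpoch_inf_shift u q 1 Hq); simpl; rewrite !Cmult_1_r; ring.
Qed.

Lemma Cmod_mult_unit (t z : C) : Cmod z = 1%R -> Cmod (t * z) = Cmod t.
Proof. intros Hz; rewrite Cmod_mult, Hz; ring. Qed.

Lemma Cmod_div_unit (t z : C) : Cmod z = 1%R -> Cmod (t / z) = Cmod t.
Proof.
intros Hz; rewrite Cmod_div, Hz; [field|apply Cmod_gt_0; lra].
Qed.

Lemma aw_weight_split (z a b c d : C) (q : R) :
  (0 < q < 1)%R ->
  aw_weight z a b c d q = (1 - z ^ 2) * (1 - / z ^ 2)
    * (qpoch_inf (z ^ 2 * q) q * qpoch_inf (/ z ^ 2 * q) q
       / qpochs_inf [a * z; a / z; b * z; b / z; c * z; c / z; d * z; d / z] q).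
Proof.
intros Hq; unfold aw_weight, qpochs_inf; cbn [fold_right].
rewrite (qpoch_inf_step (z ^ 2)), (qpoch_inf_step (/ z ^ 2)) by easy.
unfold Cdiv; ring.
Qed.

Lemma aw_denom_neq_0 (z a b c d : C) (q : R) :
  (0 < q < 1)%R -> Cmod z = 1%R ->
  (Cmod a < 1)%R -> (Cmod b < 1)%R -> (Cmod c < 1)%R -> (Cmod d < 1)%R ->
  qpochs_inf [a * z; a / z; b * z; b / z; c * z; c / z; d * z; d / z] q <> 0.
Proof.
intros Hq Hz Ha Hb Hc Hd; unfold qpochs_inf; cbn [fold_right].
repeat apply Cmult_neq_0; try apply C1_nz; apply qpoch_inf_neq_0; try easy;
  rewrite ?Cmod_mult_unit, ?Cmod_div_unit; easy.
Qed.

Definition aw_core (z a b c d : C) (q : R) : C :=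
  qpoch_inf (z ^ 2 * q) q * qpoch_inf (/ z ^ 2 * q) q
  / qpochs_inf [a * z; a / z; b * z; b / z; c * z; c / z; d * z; d / z] q.

Lemma ccont_aw_core (u : R -> C) (a b c d : C) (q : R) (x : R) :
  (0 < q < 1)%R -> ccont u x -> Cmod (u x) = 1%R ->
  (Cmod a < 1)%R -> (Cmod b < 1)%R -> (Cmod c < 1)%R -> (Cmod d < 1)%R ->
  ccont (fun t => aw_core (u t) a b c d q) x.
Proof.
intros Hq Hu Hz Ha Hb Hc Hd; unfold aw_core.
assert (Hu0 : u x <> 0) by (apply Cmod_gt_0; lra).
assert (Hui := ccont_inv u x Hu0 Hu).
assert (Hu2 := ccont_pow u 2 x Hu).
assert (Hu2i := ccont_inv _ x (Cpow_nz _ 2 Hu0) Hu2).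
apply ccont_mult.
- apply ccont_mult; apply ccont_qpoch_inf; try easy;
    apply ccont_mult; easy || apply ccont_const.
- apply ccont_inv; [apply aw_denom_neq_0; easy|].
  unfold qpochs_inf; cbn [fold_right].
  repeat apply ccont_mult; try apply ccont_const; apply ccont_qpoch_inf; try easy;
    apply ccont_mult; easy || apply ccont_const.
Qed.

Lemma aw_circle_spec (a b c d : C) (q : R) :
  (0 < q < 1)%R ->
  (Cmod a < 1)%R -> (Cmod b < 1)%R -> (Cmod c < 1)%R -> (Cmod d < 1)%R ->
  is_CInt (fun t => aw_weight (ez t) a b c d q) (- PI) PI (aw_circle a b c d q).
Proof.
intros Hq Ha Hb Hc Hd.
apply (RInt_correct (V := C_R_CompleteNormedModule)).
apply (ccont_ex_CInt (fun t => aw_weight (ez t) a b c d q)).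
intros t _.
assert (Hp := ccont_pow ez 2 t (ccont_ez t)).
assert (Hi := ccont_inv _ t (Cpow_nz _ 2 (ez_neq_0 t)) Hp).
assert (H : ccont (fun t => (1 - ez t ^ 2) * (1 - / ez t ^ 2) * aw_core (ez t) a b c d q) t).
{ apply ccont_mult.
  - apply ccont_mult; apply ccont_minus; try apply ccont_const; easy.
  - apply ccont_aw_core; try easy; [apply ccont_ez|apply Cmod_ez]. }
refine (ccont_ext _ _ _ _ H); intros s; symmetry; apply aw_weight_split, Hq.
Qed.

Lemma aw_circle_ext (a b c d a' b' c' d' : C) (q : R) :
  (forall z, aw_weight z a b c d q = aw_weight z a' b' c' d' q) ->
  aw_circle a b c d q = aw_circle a' b' c' d' q.
Proof.
intros H; apply (RInt_ext (V := C_R_CompleteNormedModule)); intros t _; apply H.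
Qed.

Lemma Cmod_mid (t : C) : (Cmod t < 1)%R -> exists r, (0 < r < 1)%R /\ (Cmod t <= r)%R.
Proof.
intros Ht; exists ((Cmod t + 1) / 2)%R; generalize (Cmod_ge_0 t); lra.
Qed.

Lemma shift_inv_aw_factor (q : R) (g : C -> C) (t : C) :
  (0 < q < 1)%R -> (Cmod t < 1)%R -> shift_inv q g ->
  shift_inv q (fun z => / qpoch_inf (t * z) q * (/ qpoch_inf (t * q / z) q * g z)).
Proof.
intros Hq Ht Hg; destruct (Cmod_mid t Ht) as [r [Hr Htr]].
assert (H0 := Cmod_ge_0 t).
assert (H1 : shift_inv q (fun z => / qpoch_inf (t * q * mon 0 1 z) q * g z)).
{ apply (shift_inv_qpoch_inf_inv q g (t * q) 0 1 r); try easy.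
  intros z Hz; assert (Hz0 := two_circles_neq_0 q z Hq Hz).
  unfold mon; simpl.
  rewrite !Cmod_mult, Cmod_inv, Cmod_1, Cmod_q, Cmod_mult, Cmod_1
    by (try apply Cmult_neq_0; try apply C1_nz; easy).
  apply Rle_trans with (Cmod t * 1)%R; [|lra].
  rewrite Rmult_assoc; apply Rmult_le_compat_l; [easy|].
  destruct Hz as [-> | ->].
  - rewrite !Rmult_1_r, Rinv_1; lra.
  - right; field; lra. }
apply (shift_inv_ext q (fun z => / qpoch_inf (t * mon 1 0 z) q
    * (/ qpoch_inf (t * q * mon 0 1 z) q * g z))); [easy| |].
- intros z Hz; assert (Hz0 := two_circles_neq_0 q z Hq Hz).
  replace (t * mon 1 0 z) with (t * z) by (unfold mon; simpl; field; apply C1_nz).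
  replace (t * q * mon 0 1 z) with (t * q / z) by (unfold mon; simpl; field; easy).
  easy.
- apply (shift_inv_qpoch_inf_inv q _ t 1 0 r); try easy.
  intros z Hz; unfold mon; simpl.
  replace (t * (z * 1 * / 1)) with (t * z) by (field; apply C1_nz).
  rewrite Cmod_mult; apply Rle_trans with (Cmod t * 1)%R; [|lra].
  apply Rmult_le_compat_l; [easy|]; destruct Hz as [-> | ->]; lra.
Qed.

(* The contour-shift function: its values at [z] and [q z], [|z| = 1], differ by a
   combination of the weights with parameters [(aq,b,c,d)] and [(a,b,c,d)], see
   [aw_weight_shift_pointwise]. *)
Definition aw_primitive (a b c d : C) (q : R) (z : C) : C :=
  z * (qpoch_inf (z ^ 2) q * (qpoch_inf (q / z ^ 2) q
  * (/ qpoch_inf (a * z) q * (/ qpoch_inf (a * q / z) q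
  * (/ qpoch_inf (b * z) q * (/ qpoch_inf (b * q / z) q
  * (/ qpoch_inf (c * z) q * (/ qpoch_inf (c * q / z) q
  * (/ qpoch_inf (d * z) q * (/ qpoch_inf (d * q / z) q * 1)))))))))).

Lemma shift_inv_aw_primitive (a b c d : C) (q : R) :
  (0 < q < 1)%R ->
  (Cmod a < 1)%R -> (Cmod b < 1)%R -> (Cmod c < 1)%R -> (Cmod d < 1)%R ->
  shift_inv q (aw_primitive a b c d q).
Proof.
intros Hq Ha Hb Hc Hd.
assert (H := shift_inv_aw_factor q _ a Hq Ha (shift_inv_aw_factor q _ b Hq Hb
  (shift_inv_aw_factor q _ c Hq Hc (shift_inv_aw_factor q _ d Hq Hd (shift_inv_1 q Hq))))).
apply (shift_inv_qpoch_inf q _ q 0 2 Hq) in H.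
apply (shift_inv_qpoch_inf q _ 1 2 0 Hq) in H.
apply (shift_inv_mon q _ 1 0 Hq) in H.
refine (shift_inv_ext q _ _ Hq _ H).
intros z Hz; assert (Hz0 := two_circles_neq_0 q z Hq Hz).
unfold aw_primitive; cbv beta.
replace (q * mon 0 2 z) with (q / z ^ 2) by (unfold mon, Cdiv; simpl; ring).
replace (1 * mon 2 0 z) with (z ^ 2) by (unfold mon; simpl; field; apply C1_nz).
replace (mon 1 0 z) with z by (unfold mon; simpl; field; apply C1_nz).
easy.
Qed.

Lemma aw_weight_shift_pointwise (a b c d z : C) (q : R) :
  (0 < q < 1)%R -> Cmod z = 1%R ->
  (Cmod a < 1)%R -> (Cmod b < 1)%R -> (Cmod c < 1)%R -> (Cmod d < 1)%R ->
  (1 - a * b * c * d) * aw_weight z (a * q) b c d q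
  = (1 - a * b) * (1 - a * c) * (1 - a * d) * aw_weight z a b c d q
    - a * (aw_primitive a b c d q z - aw_primitive a b c d q (q * z)).
Proof.
intros Hq Hz Ha Hb Hc Hd.
assert (Hz0 : z <> 0) by (apply Cmod_gt_0; lra).
assert (Hq0 := Cq_neq_0 q Hq).
unfold aw_weight, aw_primitive, qpochs_inf; cbn [fold_right].
assert (E1 : forall t, qpoch_inf (t * z) q = (1 - t * z) * qpoch_inf (t * q * z) q).
{ intros t; rewrite (qpoch_inf_step (t * z)) by easy; do 2 f_equal; ring. }
assert (E2 : forall t, qpoch_inf (t / z) q = (1 - t / z) * qpoch_inf (t * q / z) q).
{ intros t; rewrite (qpoch_inf_step (t / z)) by easy; do 2 f_equal; field; easy. }
assert (N : forall t, (Cmod t < 1)%R -> (1 - t * z <> 0 /\ z - t <> 0) /\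
  (qpoch_inf (t * q * z) q <> 0 /\ qpoch_inf (t * q / z) q <> 0)).
{ intros t Ht.
  assert (Htq : (Cmod (t * q) < 1)%R).
  { rewrite Cmod_mult, Cmod_q by easy; generalize (Cmod_ge_0 t); nra. }
  split; split.
  - apply one_minus_neq_0; rewrite Cmod_mult_unit; easy.
  - intros E; apply (one_minus_neq_0 (t / z)).
    + rewrite Cmod_div_unit; easy.
    + replace (1 - t / z) with ((z - t) / z) by (field; easy); rewrite E; field; easy.
  - apply qpoch_inf_neq_0; [easy|]; rewrite Cmod_mult_unit; easy.
  - apply qpoch_inf_neq_0; [easy|]; rewrite Cmod_div_unit; easy. }
destruct (N a Ha) as [[Na1 Na2] [Na3 Na4]].
destruct (N b Hb) as [[Nb1 Nb2] [Nb3 Nb4]].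
destruct (N c Hc) as [[Nc1 Nc2] [Nc3 Nc4]].
destruct (N d Hd) as [[Nd1 Nd2] [Nd3 Nd4]].
rewrite (qpoch_inf_step (z ^ 2)), (qpoch_inf_step (z ^ 2 * q)) by easy.
replace (qpoch_inf ((q * z) ^ 2) q) with (qpoch_inf (z ^ 2 * q * q) q)
  by (f_equal; ring).
replace (qpoch_inf (q / (q * z) ^ 2) q)
  with ((1 - / (q * z ^ 2)) * ((1 - / z ^ 2) * qpoch_inf (q / z ^ 2) q)).
2:{ replace (q / (q * z) ^ 2) with (/ (q * z ^ 2)) by (field; easy).
    rewrite (qpoch_inf_step (/ (q * z ^ 2))) by easy; f_equal.
    replace (/ (q * z ^ 2) * q) with (/ z ^ 2) by (field; easy).
    rewrite (qpoch_inf_step (/ z ^ 2)) by easy; do 2 f_equal; field; easy. }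
rewrite (qpoch_inf_step (/ z ^ 2)) by easy.
replace (/ z ^ 2 * q) with (q / z ^ 2) by (field; easy).
replace (a * q / (q * z)) with (a / z) by (field; easy).
replace (b * q / (q * z)) with (b / z) by (field; easy).
replace (c * q / (q * z)) with (c / z) by (field; easy).
replace (d * q / (q * z)) with (d / z) by (field; easy).
rewrite !(Cmult_assoc _ q z).
rewrite (E1 a), (E1 b), (E1 c), (E1 d), (E2 a), (E2 b), (E2 c), (E2 d).
generalize dependent (qpoch_inf (a * q * z) q); generalize dependent (qpoch_inf (a * q / z) q).
generalize dependent (qpoch_inf (b * q * z) q); generalize dependent (qpoch_inf (b * q / z) q).
generalize dependent (qpoch_inf (c * q * z) q); generalize dependent (qpoch_inf (c * q / z) q).
generalize dependent (qpoch_inf (d * q * z) q); generalize dependent (qpoch_inf (d * q / z) q).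
generalize (qpoch_inf (z ^ 2 * q * q) q) (qpoch_inf (q / z ^ 2) q).
intros U V; intros; clear E1 E2 N.
field; repeat split; easy.
Qed.

Lemma aw_circle_shift (a b c d : C) (q : R) :
  (0 < q < 1)%R ->
  (Cmod a < 1)%R -> (Cmod b < 1)%R -> (Cmod c < 1)%R -> (Cmod d < 1)%R ->
  (1 - a * b * c * d) * aw_circle (a * q) b c d q
  = (1 - a * b) * (1 - a * c) * (1 - a * d) * aw_circle a b c d q.
Proof.
intros Hq Ha Hb Hc Hd.
destruct (shift_inv_aw_primitive a b c d q Hq Ha Hb Hc Hd) as [_ HG].
destruct (HG 0%nat 0%nat) as [l [H1 H2]].
assert (Haq : (Cmod (a * q) < 1)%R).
{ rewrite Cmod_mult, Cmod_q by easy; generalize (Cmod_ge_0 a); nra. }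
apply (is_CInt_unique (fun t => (1 - a * b * c * d) * aw_weight (ez t) (a * q) b c d q)
  (- PI) PI).
- apply is_CInt_scal, aw_circle_spec; easy.
- replace ((1 - a * b) * (1 - a * c) * (1 - a * d) * aw_circle a b c d q)
    with ((1 - a * b) * (1 - a * c) * (1 - a * d) * aw_circle a b c d q
          + (- a * l + a * l)) by ring.
  refine (is_CInt_ext _ _ _ _ _ _
   (is_CInt_plus _ _ _ _ _ _
    (is_CInt_scal ((1 - a * b) * (1 - a * c) * (1 - a * d)) _ _ _ _
       (aw_circle_spec a b c d q Hq Ha Hb Hc Hd))
    (is_CInt_plus _ _ _ _ _ _ (is_CInt_scal (- a) _ _ _ _ H1) (is_CInt_scal a _ _ _ _ H2)))).
  intros t _; rewrite aw_weight_shift_pointwise; try easy; [|apply Cmod_ez].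
  unfold mon; simpl (_ ^ 0); rewrite Cinv_r by apply C1_nz; ring.
Qed.

Definition aw_norm (a b c d : C) (q : R) : C :=
  aw_circle a b c d q
  * qpochs_inf [a * b; a * c; a * d; b * c; b * d; c * d] q
  / qpoch_inf (a * b * c * d) q.

Lemma aw_weight_swap12 (z a b c d : C) (q : R) :
  aw_weight z a b c d q = aw_weight z b a c d q.
Proof. unfold aw_weight, Cdiv; do 2 f_equal; unfold qpochs_inf; cbn [fold_right]; ring. Qed.

Lemma aw_weight_swap13 (z a b c d : C) (q : R) :
  aw_weight z a b c d q = aw_weight z c b a d q.
Proof. unfold aw_weight, Cdiv; do 2 f_equal; unfold qpochs_inf; cbn [fold_right]; ring. Qed.

Lemma aw_weight_swap14 (z a b c d : C) (q : R) :
  aw_weight z a b c d q = aw_weight z d b c a q.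
Proof. unfold aw_weight, Cdiv; do 2 f_equal; unfold qpochs_inf; cbn [fold_right]; ring. Qed.

Lemma Cmod_mult_lt_1 (u v : C) :
  (Cmod u < 1)%R -> (Cmod v < 1)%R -> (Cmod (u * v) < 1)%R.
Proof.
intros Hu Hv; rewrite Cmod_mult.
generalize (Cmod_ge_0 u) (Cmod_ge_0 v); nra.
Qed.

Lemma Cmod_qpow_lt_1 (a : C) (q : R) (n : nat) :
  (0 < q < 1)%R -> (Cmod a < 1)%R -> (Cmod (a * q ^ n) < 1)%R.
Proof.
intros Hq Ha; eapply Rle_lt_trans; [apply Cmod_qpow_mult, Hq|exact Ha].
Qed.

Lemma aw_norm_shift1 (a b c d : C) (q : R) :
  (0 < q < 1)%R ->
  (Cmod a < 1)%R -> (Cmod b < 1)%R -> (Cmod c < 1)%R -> (Cmod d < 1)%R ->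
  aw_norm (a * q) b c d q = aw_norm a b c d q.
Proof.
intros Hq Ha Hb Hc Hd.
assert (Habcd : (Cmod (a * b * c * d) < 1)%R) by (repeat apply Cmod_mult_lt_1; easy).
assert (N1 := one_minus_neq_0 _ Habcd).
assert (N2 : qpoch_inf (a * b * c * d * q) q <> 0).
{ apply qpoch_inf_neq_0; [easy|].
  replace (RtoC q) with (RtoC q ^ 1) by (simpl; ring); apply Cmod_qpow_lt_1; easy. }
assert (HI := aw_circle_shift a b c d q Hq Ha Hb Hc Hd).
unfold aw_norm, qpochs_inf; cbn [fold_right].
rewrite (qpoch_inf_step (a * b)), (qpoch_inf_step (a * c)), (qpoch_inf_step (a * d)),
  (qpoch_inf_step (a * b * c * d)) by easy.
replace (a * q * b * c * d) with (a * b * c * d * q) by ring.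
replace (a * q * b) with (a * b * q) by ring.
replace (a * q * c) with (a * c * q) by ring.
replace (a * q * d) with (a * d * q) by ring.
set (F := qpoch_inf (a * b * q) q * qpoch_inf (a * c * q) q * qpoch_inf (a * d * q) q
  * qpoch_inf (b * c) q * qpoch_inf (b * d) q * qpoch_inf (c * d) q
  / qpoch_inf (a * b * c * d * q) q).
apply (Cmult_cancel_l (1 - a * b * c * d)); [easy|].
transitivity ((1 - a * b * c * d) * aw_circle (a * q) b c d q * F).
- unfold F; field; easy.
- rewrite HI; unfold F; field; split; easy.
Qed.

Lemma aw_norm_swap12 (a b c d : C) (q : R) : aw_norm a b c d q = aw_norm b a c d q.
Proof.
unfold aw_norm; rewrite (aw_circle_ext a b c d b a c d q)
  by (intros; apply aw_weight_swap12).
unfold qpochs_inf; cbn [fold_right].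
replace (a * b * c * d) with (b * a * c * d) by ring.
rewrite (Cmult_comm a b); unfold Cdiv; ring.
Qed.

Lemma aw_norm_swap13 (a b c d : C) (q : R) : aw_norm a b c d q = aw_norm c b a d q.
Proof.
unfold aw_norm; rewrite (aw_circle_ext a b c d c b a d q)
  by (intros; apply aw_weight_swap13).
unfold qpochs_inf; cbn [fold_right].
replace (a * b * c * d) with (c * b * a * d) by ring.
rewrite (Cmult_comm a b), (Cmult_comm a c), (Cmult_comm b c); unfold Cdiv; ring.
Qed.

Lemma aw_norm_swap14 (a b c d : C) (q : R) : aw_norm a b c d q = aw_norm d b c a q.
Proof.
unfold aw_norm; rewrite (aw_circle_ext a b c d d b c a q)
  by (intros; apply aw_weight_swap14).
unfold qpochs_inf; cbn [fold_right].
replace (a * b * c * d) with (d * b * c * a) by ring.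
rewrite (Cmult_comm a b), (Cmult_comm a c), (Cmult_comm a d), (Cmult_comm b d),
  (Cmult_comm c d); unfold Cdiv; ring.
Qed.

Lemma aw_norm_shift (a b c d : C) (q : R) (n : nat) :
  (0 < q < 1)%R ->
  (Cmod a < 1)%R -> (Cmod b < 1)%R -> (Cmod c < 1)%R -> (Cmod d < 1)%R ->
  aw_norm (a * q ^ n) (b * q ^ n) (c * q ^ n) (d * q ^ n) q = aw_norm a b c d q.
Proof.
intros Hq Ha Hb Hc Hd; induction n as [|n IH].
- simpl; rewrite !Cmult_1_r; easy.
- assert (Ha' := Cmod_qpow_lt_1 a q n Hq Ha); assert (Hb' := Cmod_qpow_lt_1 b q n Hq Hb).
  assert (Hc' := Cmod_qpow_lt_1 c q n Hq Hc); assert (Hd' := Cmod_qpow_lt_1 d q n Hq Hd).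
  assert (Hb2 := Cmod_qpow_lt_1 b q (S n) Hq Hb).
  assert (Hc2 := Cmod_qpow_lt_1 c q (S n) Hq Hc).
  assert (Hd2 := Cmod_qpow_lt_1 d q (S n) Hq Hd).
  assert (E : forall t : C, t * q ^ n * q = t * q ^ S n) by (intros; simpl; ring).
  rewrite <- IH, <- (E a), aw_norm_shift1 by easy.
  rewrite aw_norm_swap12, <- (E b), aw_norm_shift1, aw_norm_swap12 by easy.
  rewrite aw_norm_swap13, <- (E c), aw_norm_shift1, aw_norm_swap13 by easy.
  rewrite aw_norm_swap14, <- (E d), aw_norm_shift1, aw_norm_swap14 by easy.
  easy.
Qed.

Lemma qpoch_inf_ucv_1 {X : Type} (S : X -> Prop) (f : nat -> X -> C) (q M : R) :
  (0 < q < 1)%R -> (forall n x, S x -> (Cmod (f n x) <= M * q ^ n)%R) ->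
  ucv S (fun n x => qpoch_inf (f n x) q) (fun _ => 1).
Proof.
intros Hq Hf eps He.
set (K := (exp (Rabs M / (1 - q)) / (1 - q))%R).
assert (HK : (0 < K)%R) by (apply Rdiv_lt_0_compat; [apply exp_pos|lra]).
destruct (pow_lt_eps q (K * M) eps Hq He) as [N HN]; exists N; intros n x Hn Hx.
eapply Rle_lt_trans; [|apply (HN n Hn)].
specialize (Hf n x Hx); assert (Hp := pow_le_1 q n Hq).
rewrite <- (qpoch_inf_0 q).
eapply Rle_trans; [apply (qpoch_inf_lipschitz _ _ q (Rabs M) Hq)|].
- generalize (Rle_abs M) (Rabs_pos M); nra.
- rewrite Cmod_0; apply Rabs_pos.
- fold K; rewrite Rmult_assoc; apply Rmult_le_compat_l; [lra|].
  replace (f n x - 0) with (f n x) by ring; easy.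
Qed.

Lemma ucv_mult_1 {X : Type} (S : X -> Prop) (f g : nat -> X -> C) :
  ucv S f (fun _ => 1) -> ucv S g (fun _ => 1) ->
  ucv S (fun n x => f n x * g n x) (fun _ => 1).
Proof.
intros Hf Hg.
refine (ucv_ext _ _ _ _ _ _ _ (ucv_mult S f g (fun _ => 1) (fun _ => 1)
  (bdd_const _ _) (bdd_const _ _) Hf Hg)); intros; [easy|ring].
Qed.

Lemma aw_norm_const (a b c d : C) (q : R) :
  (0 < q < 1)%R ->
  (Cmod a < 1)%R -> (Cmod b < 1)%R -> (Cmod c < 1)%R -> (Cmod d < 1)%R ->
  aw_norm a b c d q = aw_circle 0 0 0 0 q.
Proof.
intros Hq Ha Hb Hc Hd.
assert (H0 : (Cmod 0 < 1)%R) by (rewrite Cmod_0; lra).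
set (S := fun _ : R => True).
assert (F : forall t, (Cmod t < 1)%R -> forall u : R -> C, (forall s, Cmod (u s) = 1%R) ->
  ucv S (fun n s => qpoch_inf (t * q ^ n * u s) q) (fun _ => 1)).
{ intros t Ht u Hu; apply (qpoch_inf_ucv_1 S _ q 1 Hq).
  intros n s _; rewrite !Cmod_mult, Hu, Cmod_pow, Cmod_q by easy.
  assert (Hp := pow_le_1 q n Hq); nra. }
assert (Hez : forall s, Cmod (/ ez s) = 1%R) by (intros; rewrite ez_inv; apply Cmod_ez).
assert (D : ucv S (fun n s => / qpochs_inf [a * q ^ n * ez s; a * q ^ n / ez s;
   b * q ^ n * ez s; b * q ^ n / ez s; c * q ^ n * ez s; c * q ^ n / ez s;
   d * q ^ n * ez s; d * q ^ n / ez s] q) (fun _ => / 1)).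
{ apply (ucv_inv S _ (fun _ => 1) 1); [lra|intros; rewrite Cmod_1; lra|].
  unfold qpochs_inf; cbn [fold_right].
  repeat apply ucv_mult_1; try apply ucv_const;
    apply F; try easy; apply Cmod_ez. }
assert (W : ucv S (fun n s => aw_weight (ez s) (a * q ^ n) (b * q ^ n) (c * q ^ n)
   (d * q ^ n) q) (fun s => aw_weight (ez s) 0 0 0 0 q)).
{ refine (ucv_ext _ _ _ _ _ _ _ (ucv_mult S
    (fun _ s => qpochs_inf [ez s ^ 2; / ez s ^ 2] q) _
    (fun s => qpochs_inf [ez s ^ 2; / ez s ^ 2] q) (fun _ => / 1) _ (bdd_const _ _)
    (ucv_const _ _) D)).
  - intros; reflexivity.
  - intros s _; unfold aw_weight, Cdiv; f_equal; f_equal.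
    unfold qpochs_inf; cbn [fold_right].
    rewrite !Cmult_0_l, !qpoch_inf_0; ring.
  - exists (exp (1 / (1 - q)) * (exp (1 / (1 - q)) * 1))%R; intros s _.
    unfold qpochs_inf; cbn [fold_right]; rewrite !Cmod_mult, Cmod_1.
    repeat apply Rmult_le_compat; try (apply Rmult_le_pos); try apply Cmod_ge_0; try lra;
      apply qpoch_inf_bound; try easy.
    + rewrite Cmod_pow, Cmod_ez; lra.
    + rewrite Cmod_inv by apply Cpow_nz, ez_neq_0.
      rewrite Cmod_pow, Cmod_ez, pow1, Rinv_1; lra. }
destruct (is_CInt_ucv _ _ (fun n => aw_circle (a * q ^ n) (b * q ^ n) (c * q ^ n)
  (d * q ^ n) q) (- PI) PI
  (fun n => aw_circle_spec _ _ _ _ q Hq (Cmod_qpow_lt_1 a q n Hq Ha)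
    (Cmod_qpow_lt_1 b q n Hq Hb) (Cmod_qpow_lt_1 c q n Hq Hc)
    (Cmod_qpow_lt_1 d q n Hq Hd)) W) as [l [Hl Hc']].
rewrite (is_CInt_unique _ _ _ _ _ (aw_circle_spec 0 0 0 0 q Hq H0 H0 H0 H0) Hl).
apply (cseq_unique (fun n => aw_norm (a * q ^ n) (b * q ^ n) (c * q ^ n) (d * q ^ n) q)).
- intros eps He; exists O; intros n x _ _; rewrite aw_norm_shift by easy.
  replace (_ - _) with (RtoC 0) by ring; rewrite Cmod_0; easy.
- set (T := fun _ : unit => True).
  assert (G : forall s t, (Cmod s < 1)%R -> (Cmod t < 1)%R ->
    ucv T (fun n _ => qpoch_inf (s * q ^ n * (t * q ^ n)) q) (fun _ => 1)).
  { intros s t Hs Ht; apply (qpoch_inf_ucv_1 T _ q 1 Hq); intros n _ _.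
    assert (H1 := Cmod_qpow_lt_1 t q n Hq Ht); assert (H2 := Cmod_ge_0 (t * q ^ n)).
    rewrite Cmod_mult, (Cmod_mult s), Cmod_pow, Cmod_q by easy.
    assert (Hp := pow_le_1 q n Hq).
    assert (H3 := Cmod_ge_0 s).
    apply Rle_trans with (1 * q ^ n * 1)%R; [|lra].
    apply Rmult_le_compat; [nra|easy|nra|lra]. }
  refine (ucv_ext _ _ _ _ _ _ _ (ucv_mult T _ _ _ _ (bdd_const _ l) (bdd_const _ 1) Hc'
    (ucv_mult_1 T (fun n _ => qpochs_inf [a * q ^ n * (b * q ^ n); a * q ^ n * (c * q ^ n);
       a * q ^ n * (d * q ^ n); b * q ^ n * (c * q ^ n); b * q ^ n * (d * q ^ n);
       c * q ^ n * (d * q ^ n)] q)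
     (fun n _ => / qpoch_inf (a * q ^ n * (b * q ^ n) * (c * q ^ n) * (d * q ^ n)) q) _ _))).
  + intros n x _; unfold aw_norm, Cdiv; ring.
  + intros; ring.
  + unfold qpochs_inf; cbn [fold_right].
    repeat apply ucv_mult_1; try apply ucv_const; apply G; easy.
  + refine (ucv_ext _ _ _ _ _ _ _ (ucv_inv T _ (fun _ => 1) 1 Rlt_0_1 _ _)).
    * intros; reflexivity.
    * intros; field; apply C1_nz.
    * intros; rewrite Cmod_1; lra.
    * apply (qpoch_inf_ucv_1 T _ q 1 Hq); intros n _ _.
      rewrite <- !Cmult_assoc, (Cmod_mult a).
      assert (H1 := Cmod_qpow_lt_1 b q n Hq Hb).
      assert (H2 := Cmod_qpow_lt_1 c q n Hq Hc).
      assert (H3 := Cmod_qpow_lt_1 d q n Hq Hd).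
      replace (q ^ n * (b * (q ^ n * (c * (q ^ n * (d * q ^ n))))))
        with (q ^ n * ((b * q ^ n) * ((c * q ^ n) * (d * q ^ n)))) by ring.
      assert (H4 := Cmod_mult_lt_1 _ _ H1 (Cmod_mult_lt_1 _ _ H2 H3)).
      rewrite (Cmod_mult (q ^ n)), Cmod_pow, Cmod_q by easy.
      assert (Hp := pow_le_1 q n Hq).
      generalize (Cmod_ge_0 a) (Cmod_ge_0 (b * q ^ n * (c * q ^ n * (d * q ^ n)))); intros.
      apply Rmult_le_compat; [easy|nra|lra|nra].
Qed.

Lemma RtoC_sqrt_sqr (q : R) : (0 < q < 1)%R -> RtoC (sqrt q) * RtoC (sqrt q) = q.
Proof. intros Hq; rewrite <- RtoC_mult, sqrt_sqrt by lra; easy. Qed.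

Lemma qpoch_double (u : C) (q : R) (n : nat) : (0 < q < 1)%R ->
  qpoch (u ^ 2) q (n + n)
  = qpoch u q n * (qpoch (- u) q n
    * (qpoch (sqrt q * u) q n * qpoch (- (sqrt q * u)) q n)).
Proof.
intros Hq; induction n as [|n IH]; [simpl; ring|].
replace (S n + S n)%nat with (S (S (n + n))) by lia.
cbn [qpoch]; rewrite IH, (Cpow_S q), Cpow_add_r.
set (s := RtoC (sqrt q)) in *.
replace (u ^ 2 * (q * (q ^ n * q ^ n))) with ((s * u * q ^ n) * (s * u * q ^ n)).
- ring.
- transitivity (s * s * (u ^ 2 * (q ^ n * q ^ n))); [ring|].
  unfold s; rewrite RtoC_sqrt_sqr by easy; ring.
Qed.

Lemma qpoch_inf_double (u : C) (q : R) : (0 < q < 1)%R ->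
  qpoch_inf (u ^ 2) q
  = qpoch_inf u q * (qpoch_inf (- u) q
    * (qpoch_inf (sqrt q * u) q * qpoch_inf (- (sqrt q * u)) q)).
Proof.
intros Hq; apply (cseq_unique (fun n => qpoch (u ^ 2) q (n + n))).
- intros eps He; destruct (qpoch_cseq (u ^ 2) q Hq eps He) as [N HN].
  exists N; intros n x Hn Hx; exact (HN (n + n)%nat x ltac:(lia) Hx).
- set (S := fun _ : unit => True).
  assert (M : forall (f g : nat -> C) (l m : C), cseq f l -> cseq g m ->
    cseq (fun n => f n * g n) (l * m)).
  { intros f g l m; apply (ucv_mult S (fun n _ => f n) (fun n _ => g n)
      (fun _ => l) (fun _ => m)); apply bdd_const. }
  refine (ucv_ext _ _ _ _ _ _ _ (M _ _ _ _ (qpoch_cseq u q Hq) (M _ _ _ _ (qpoch_cseq (- u) q Hq)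
    (M _ _ _ _ (qpoch_cseq (sqrt q * u) q Hq) (qpoch_cseq (- (sqrt q * u)) q Hq))))).
  + intros n x _; symmetry; apply qpoch_double, Hq.
  + easy.
Qed.

(* With these parameters the weight collapses to [(1 - z^2)(1 - z^-2)]. *)
Lemma aw_circle_special (q : R) : (0 < q < 1)%R ->
  aw_circle q (- q) (sqrt q) (- sqrt q) q = RtoC (4 * PI).
Proof.
intros Hq; set (s := RtoC (sqrt q)).
assert (Hs : (Cmod s < 1)%R).
{ unfold s; rewrite Cmod_R, Rabs_pos_eq by apply sqrt_pos.
  rewrite <- sqrt_1; apply sqrt_lt_1; lra. }
assert (Hq1 : (Cmod q < 1)%R) by (rewrite Cmod_q; lra).
apply (is_CInt_unique (fun t => aw_weight (ez t) q (- q) s (- s) q) (- PI) PI).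
- apply aw_circle_spec; try rewrite Cmod_opp; easy.
- assert (H := is_CInt_plus _ _ _ _ _ _
    (is_CInt_scal 2 _ _ _ _ (is_CInt_mon 0 0))
    (is_CInt_scal (- (1)) _ _ _ _ (is_CInt_plus _ _ _ _ _ _ (is_CInt_mon 2 0) (is_CInt_mon 0 2)))).
  simpl Nat.eq_dec in H; cbv iota in H.
  replace (RtoC (4 * PI)) with (2 * RtoC (2 * PI) + - (1) * (0 + 0)).
  2:{ replace (4 * PI)%R with (2 * (2 * PI))%R by ring; rewrite (RtoC_mult 2 (2 * PI)); ring. }
  refine (is_CInt_ext _ _ _ _ _ _ H); intros t _.
  assert (Hz := Cmod_ez t); set (z := ez t) in *.
  assert (Hz0 : z <> 0) by apply ez_neq_0.
  unfold aw_weight, qpochs_inf; cbn [fold_right].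
  replace (/ z ^ 2) with ((/ z) ^ 2) by (field; easy).
  rewrite !qpoch_inf_double by easy; fold s.
  rewrite (qpoch_inf_step z), (qpoch_inf_step (- z)), (qpoch_inf_step (/ z)),
    (qpoch_inf_step (- / z)) by easy.
  replace (z * q) with (q * z) by ring.
  replace (/ z * q) with (q / z) by (field; easy).
  replace (- z * q) with (- q * z) by ring.
  replace (- / z * q) with (- q / z) by (field; easy).
  replace (- (s * z)) with (- s * z) by ring.
  replace (- (s * / z)) with (- s / z) by (field; easy).
  replace (s * / z) with (s / z) by (field; easy).
  assert (N : forall u, (Cmod u < 1)%R ->
    qpoch_inf (u * z) q <> 0 /\ qpoch_inf (u / z) q <> 0).
  { intros u Hu; split; (apply qpoch_inf_neq_0; [easy|]);
      rewrite ?Cmod_mult_unit, ?Cmod_div_unit; easy. }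
  destruct (N q Hq1); destruct (N s Hs).
  destruct (N (- q)); [rewrite Cmod_opp; easy|].
  destruct (N (- s)); [rewrite Cmod_opp; easy|].
  unfold mon; simpl (_ ^ 0); field; repeat split; easy.
Qed.

Lemma askey_wilson_circle (a b c d : C) (q : R) :
  (0 < q < 1)%R ->
  (Cmod a < 1)%R -> (Cmod b < 1)%R -> (Cmod c < 1)%R -> (Cmod d < 1)%R ->
  aw_circle a b c d q
  = RtoC (4 * PI) * qpoch_inf (a * b * c * d) q
    / (qpoch_inf q q * qpochs_inf [a * b; a * c; a * d; b * c; b * d; c * d] q).
Proof.
intros Hq Ha Hb Hc Hd; set (s := RtoC (sqrt q)).
assert (Hss : s * s = q) by apply (RtoC_sqrt_sqr q Hq).
assert (Hs : (Cmod s < 1)%R).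
{ unfold s; rewrite Cmod_R, Rabs_pos_eq by apply sqrt_pos.
  rewrite <- sqrt_1; apply sqrt_lt_1; lra. }
assert (Hq1 : (Cmod q < 1)%R) by (rewrite Cmod_q; lra).
assert (Hqo : (Cmod (- q) < 1)%R) by (rewrite Cmod_opp; easy).
assert (Hso : (Cmod (- s) < 1)%R) by (rewrite Cmod_opp; easy).
assert (P0 : forall u, (Cmod u < 1)%R -> qpoch_inf u q <> 0)
  by (intros; apply qpoch_inf_neq_0; easy).
assert (E0 : aw_norm a b c d q = RtoC (4 * PI) / qpoch_inf q q).
{ rewrite (aw_norm_const a b c d) by easy.
  rewrite <- (aw_norm_const q (- q) s (- s)) by easy.
  unfold aw_norm, s; rewrite aw_circle_special by easy; fold s.
  assert (D := qpoch_inf_double s q Hq); fold s in D.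
  replace (s ^ 2) with (RtoC q) in D by (rewrite <- Hss; ring).
  rewrite Hss in D.
  assert (D' : qpoch_inf s q * qpoch_inf (- s) q * qpoch_inf (- q) q = 1).
  { apply (Cmult_cancel_l (qpoch_inf q q)); [apply P0, Hq1|].
    rewrite Cmult_1_r.
    transitivity (qpoch_inf s q * (qpoch_inf (- s) q * (qpoch_inf q q * qpoch_inf (- q) q)));
      [ring|symmetry; exact D]. }
  rewrite (qpoch_inf_step s), (qpoch_inf_step (- s)), (qpoch_inf_step (- q)) in D' by easy.
  replace (qpoch_inf q q) with ((1 - q) * ((1 - q * q) * qpoch_inf (q * q * q) q))
    by (rewrite (qpoch_inf_step q), (qpoch_inf_step (q * q)) by easy; easy).
  unfold qpochs_inf; cbn [fold_right].
  replace (q * - q * s * - s) with (q * q * q) by (rewrite <- Hss; ring).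
  replace (s * - s) with (- q) by (rewrite <- Hss; ring).
  rewrite (qpoch_inf_step (- q)) by easy.
  replace (- q * s) with (- s * q) by ring; replace (- q * - s) with (s * q) by ring.
  replace (q * - s) with (- s * q) by ring; replace (q * s) with (s * q) by ring.
  replace (q * - q) with (- q * q) by ring.
  assert (N1 : 1 - q <> 0) by (apply one_minus_neq_0; easy).
  assert (N2 : 1 - q * q <> 0) by (apply one_minus_neq_0, Cmod_mult_lt_1; easy).
  assert (N3 : qpoch_inf (q * q * q) q <> 0)
    by (apply P0; repeat apply Cmod_mult_lt_1; easy).
  set (A := qpoch_inf (s * q) q) in *; set (B := qpoch_inf (- s * q) q) in *.
  set (Q := qpoch_inf (- q * q) q) in *; set (T := qpoch_inf (q * q * q) q) in *.
  assert (D2 : (1 - q) * (1 - q) * (1 + q) * (1 + q) * (A * A * B * B * Q * Q) = 1).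
  { transitivity (((1 - s) * A * ((1 - - s) * B) * ((1 - - q) * Q))
       * ((1 - s) * A * ((1 - - s) * B) * ((1 - - q) * Q))); [rewrite <- Hss; ring|].
    rewrite D'; ring. }
  transitivity (RtoC (4 * PI)
    * ((1 - q) * (1 - q) * (1 + q) * (1 + q) * (A * A * B * B * Q * Q))
    / ((1 - q) * (1 - q * q) * T)); [field; repeat split; easy|].
  rewrite D2; field; repeat split; easy. }
rewrite <- (Cmult_1_r (aw_circle a b c d q)).
unfold aw_norm in E0.
assert (N1 : qpoch_inf (a * b * c * d) q <> 0)
  by (apply P0; repeat apply Cmod_mult_lt_1; easy).
assert (N2 : qpochs_inf [a * b; a * c; a * d; b * c; b * d; c * d] q <> 0).
{ unfold qpochs_inf; cbn [fold_right].
  repeat apply Cmult_neq_0; try apply C1_nz; apply P0, Cmod_mult_lt_1; easy. }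
assert (N3 := P0 _ Hq1).
set (Z := qpochs_inf _ q) in *; set (I := aw_circle a b c d q) in *.
transitivity (I * Z / qpoch_inf (a * b * c * d) q * (qpoch_inf (a * b * c * d) q / Z));
  [field; easy|].
rewrite E0; field; easy.
Qed.

Lemma Cmod_zof (x : R) : (-1 <= x <= 1)%R -> Cmod (zof x) = 1%R.
Proof.
intros Hx; unfold Cmod, zof; cbn [fst snd].
rewrite (pow2_sqrt (1 - x ^ 2)) by nra.
replace (x ^ 2 + (1 - x ^ 2))%R with 1%R by ring; apply sqrt_1.
Qed.

Lemma zof_cos (t : R) : (0 <= t <= PI)%R -> zof (cos t) = ez t.
Proof.
intros Ht; unfold zof, ez; f_equal.
assert (H := sin2_cos2 t); unfold Rsqr in H.
replace (1 - cos t ^ 2)%R with (sin t * sin t)%R by (simpl; lra).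
apply sqrt_square, sin_ge_0; lra.
Qed.

Lemma ccont_zof (x : R) : (-1 <= x <= 1)%R -> ccont zof x.
Proof.
intros Hx; split; [apply derivable_continuous_pt, derivable_pt_id|].
apply (continuity_pt_comp (fun x => 1 - x ^ 2)%R sqrt).
- apply derivable_continuous_pt; reg.
- apply continuity_pt_sqrt; nra.
Qed.

Lemma zof_factor (x : R) : (-1 <= x <= 1)%R ->
  (1 - zof x ^ 2) * (1 - / zof x ^ 2) = RtoC (4 * (1 - x ^ 2)).
Proof.
intros Hx.
assert (Hz0 : zof x <> 0) by (apply Cmod_gt_0; rewrite Cmod_zof; lra).
transitivity (4 - (zof x + / zof x) ^ 2); [field; easy|].
replace (zof x + / zof x) with (2 * x).
- rewrite RtoC_mult, RtoC_minus, RtoC_pow; ring.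
- rewrite (zof_spec x Hx) at 1; field; easy.
Qed.

Lemma aw_real_integral (a b c d : C) (q : R) :
  (0 < q < 1)%R ->
  (Cmod a < 1)%R -> (Cmod b < 1)%R -> (Cmod c < 1)%R -> (Cmod d < 1)%R ->
  is_CInt (fun x => aw_weight (zof x) a b c d q * RtoC (/ sqrt (1 - x ^ 2)))
    (-1) 1 (aw_circle a b c d q / 2).
Proof.
intros Hq Ha Hb Hc Hd.
set (f := fun x => RtoC (4 * sqrt (1 - x ^ 2)) * aw_core (zof x) a b c d q).
assert (Hf : forall x, (-1 <= x <= 1)%R -> ccont f x).
{ intros x Hx; apply ccont_mult.
  - split; simpl; [|apply continuity_pt_const; intros ? ?; easy].
    apply (continuity_pt_scal (fun x => sqrt (1 - x * (x * 1)))%R 4).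
    apply (ccont_zof x Hx).
  - apply ccont_aw_core; try easy; [apply ccont_zof|apply Cmod_zof]; easy. }
destruct (ccont_ex_CInt f (-1) 1) as [L HL].
{ intros x Hx; apply Hf; revert Hx; rewrite Rmin_left, Rmax_right; lra. }
set (w := fun t => aw_weight (ez t) a b c d q).
assert (Hw : is_CInt w 0 PI L).
{ assert (H := is_RInt_comp (V := C_R_CompleteNormedModule) f cos (fun t => - sin t)%R PI 0).
  rewrite cos_PI, cos_0, (is_RInt_unique (V := C_R_CompleteNormedModule) f (-1) 1 L HL) in H.
  assert (H' := is_RInt_swap (V := C_R_NormedModule) _ _ _ _
    (H ltac:(intros t _; apply ccont_continuous, Hf, COS_bound)
       ltac:(intros t _; split; [auto_derive; [easy|ring]|
         apply continuity_pt_filterlim; apply derivable_continuous_pt; reg]))).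
  clear H.
  apply (is_CInt_scal (- (1))) in H'.
  replace L with (- (1) * opp (L : C_R_NormedModule)).
  2:{ transitivity (- (1) * (- L)); [reflexivity|ring]. }
  refine (is_CInt_ext _ _ _ _ _ _ H'); intros t Ht.
  rewrite Rmin_left, Rmax_right in Ht by (generalize PI_RGT_0; lra).
  transitivity (- (1) * (RtoC (- sin t) * f (cos t))).
  { f_equal; destruct (f (cos t)) as [u v].
    unfold scal; simpl; unfold prod_scal, scal; simpl; unfold mult; simpl.
    unfold Cmult, RtoC; simpl; f_equal; ring. }
  unfold f, w; rewrite zof_cos by lra.
  rewrite aw_weight_split by easy; fold (aw_core (ez t) a b c d q).
  rewrite <- zof_cos, zof_factor by (try apply COS_bound; lra).
  assert (H := sin2_cos2 t); unfold Rsqr in H.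
  replace (1 - cos t ^ 2)%R with (sin t * sin t)%R by (simpl; lra).
  rewrite sqrt_square by (apply sin_ge_0; lra).
  rewrite RtoC_opp, !RtoC_mult; ring. }
assert (Hw' : is_CInt w (- PI) 0 L).
{ assert (H : is_CInt w (- - PI) (- 0) (opp (L : C_R_NormedModule))).
  { rewrite Ropp_involutive, Ropp_0; apply (is_RInt_swap (V := C_R_NormedModule)), Hw. }
  apply (is_RInt_comp_opp (V := C_R_NormedModule)) in H.
  apply (is_CInt_scal (- (1))) in H.
  replace L with (- (1) * opp (L : C_R_NormedModule)).
  2:{ transitivity (- (1) * (- L)); [reflexivity|ring]. }
  refine (is_CInt_ext _ _ _ _ _ _ H); intros t Ht.
  transitivity (- (1) * - w (- t)%R); [reflexivity|].
  unfold w; rewrite <- ez_inv.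
  assert (Hz0 := ez_neq_0 t); set (z := ez t) in *.
  unfold aw_weight, qpochs_inf; cbn [fold_right].
  replace ((/ z) ^ 2) with (/ z ^ 2) by (field; easy).
  replace (/ / z ^ 2) with (z ^ 2) by (field; easy).
  assert (E : forall u, u / / z = u * z) by (intros; field; easy).
  rewrite !E; unfold Cdiv.
  match goal with |- _ * - ?X = _ => transitivity X; [ring|] end.
  f_equal; [ring|f_equal; ring]. }
assert (HC : is_CInt w (- PI) PI (L + L))
  by (apply (is_RInt_Chasles (V := C_R_NormedModule) w (- PI) 0 PI); easy).
rewrite (is_CInt_unique _ _ _ _ _ (aw_circle_spec a b c d q Hq Ha Hb Hc Hd) HC).
replace ((L + L) / 2) with L by field.
refine (is_CInt_ext _ _ _ _ _ _ HL); intros x Hx.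
rewrite Rmin_left, Rmax_right in Hx by lra.
unfold f; rewrite aw_weight_split by easy; fold (aw_core (zof x) a b c d q).
rewrite zof_factor by lra.
assert (Hs : (0 < 1 - x ^ 2)%R) by nra.
assert (Hs' := sqrt_lt_R0 _ Hs).
replace (4 * (1 - x ^ 2))%R with (4 * sqrt (1 - x ^ 2) * sqrt (1 - x ^ 2))%R
  by (rewrite Rmult_assoc, sqrt_sqrt; lra).
rewrite (RtoC_mult (4 * sqrt (1 - x ^ 2))), RtoC_inv by lra.
field; apply RtoC_neq_0; lra.
Qed.

(** * Terminating series and the double sum *)

Lemma Cinv_0 : / RtoC 0 = 0.
Proof. unfold Cinv, RtoC; simpl; unfold Rdiv; rewrite Ropp_0, !Rmult_0_l; easy. Qed.

Lemma Cinv_mult (u v : C) : / (u * v) = / u * / v.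
Proof.
destruct (Ceq_dec u 0) as [->|Hu]; [rewrite Cmult_0_l, !Cinv_0; ring|].
destruct (Ceq_dec v 0) as [->|Hv]; [rewrite Cmult_0_r, !Cinv_0; ring|].
field; easy.
Qed.

Lemma qpow_opp (q : R) (n : nat) :
  (0 < q < 1)%R -> qpow q (- Z.of_nat n) = / q ^ n.
Proof.
intros Hq; unfold qpow.
rewrite powerRZ_neg', <- pow_powerRZ, RtoC_inv, RtoC_pow by (apply pow_nonzero; lra).
easy.
Qed.

Lemma qpow_pred (q : R) (n : nat) :
  (0 < q < 1)%R -> qpow q (Z.of_nat n - 1) = q ^ n / q.
Proof.
intros Hq; unfold qpow; rewrite <- RtoC_pow, <- RtoC_div by lra; f_equal.
unfold Z.sub; rewrite powerRZ_add, <- pow_powerRZ by lra; simpl; field; lra.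
Qed.

Lemma qpow_one_minus (q : R) (n : nat) :
  (0 < q < 1)%R -> qpow q (1 - Z.of_nat n) = q / q ^ n.
Proof.
intros Hq; unfold Z.sub, qpow; rewrite powerRZ_add, RtoC_mult by lra.
fold (qpow q (- Z.of_nat n)); rewrite qpow_opp by easy; simpl; rewrite Rmult_1_r; easy.
Qed.

Lemma qpoch_inv_qpow_0 (q : R) (n m : nat) :
  (0 < q < 1)%R -> qpoch (/ q ^ n) q (S n + m) = 0.
Proof.
intros Hq; rewrite qpoch_add; cbn [qpoch].
rewrite Cinv_l by apply Cpow_nz, Cq_neq_0, Hq; ring.
Qed.

Lemma sum_n_csum (f : nat -> C) (n : nat) : sum_n f n = csum f (S n).
Proof.
induction n as [|n IH].
- rewrite sum_O; simpl; ring.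
- rewrite sum_Sn, IH; reflexivity.
Qed.

Lemma phi43_terminating (n : nat) (a2 a3 a4 b1 b2 b3 : C) (q : R) :
  (0 < q < 1)%R ->
  phi43 (qpow q (- Z.of_nat n)) a2 a3 a4 b1 b2 b3 q q
  = csum (fun j => qbin_inv q n j * (qpoch a2 q j * qpoch a3 q j * qpoch a4 q j)
      / (qpoch b1 q j * qpoch b2 q j * qpoch b3 q j)) (S n).
Proof.
intros Hq; apply cseq_CLim_seq; rewrite qpow_opp by easy.
set (f := fun j => qpochs [/ q ^ n; a2; a3; a4] q j
   / qpochs [RtoC q; b1; b2; b3] q j * q ^ j).
assert (Hf : forall m, csum f (S n + m) = csum f (S n)).
{ induction m as [|m IH]; [f_equal; lia|].
  rewrite Nat.add_succ_r.
  transitivity (csum f (S n + m) + f (S n + m)%nat); [easy|].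
  rewrite IH; replace (f (S n + m)%nat) with (RtoC 0); [ring|].
  unfold f, qpochs; cbn [fold_right].
  rewrite qpoch_inv_qpow_0 by easy; unfold Cdiv; ring. }
intros eps He; exists n; intros m x Hm _.
rewrite sum_n_csum; replace (S m) with (S n + (m - n))%nat by lia; rewrite Hf.
rewrite (csum_ext f (fun j => qbin_inv q n j * (qpoch a2 q j * qpoch a3 q j * qpoch a4 q j)
      / (qpoch b1 q j * qpoch b2 q j * qpoch b3 q j))).
- unfold Cminus; rewrite Cplus_opp_r, Cmod_0; easy.
- intros j _; unfold f, qbin_inv, qpochs; cbn [fold_right].
  unfold Cdiv; rewrite !Cmult_1_r.
  rewrite !Cinv_mult; ring.
Qed.

Lemma qpoch_neq_0_le (a : C) (q : R) (j n : nat) :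
  (j <= n)%nat -> qpoch a q n <> 0 -> qpoch a q j <> 0.
Proof.
intros Hj H E; apply H; replace n with (j + (n - j))%nat by lia.
rewrite qpoch_add, E; ring.
Qed.

Lemma qpoch_split (a : C) (q : R) (j n : nat) :
  (j <= n)%nat -> qpoch a q n = qpoch a q j * qpoch (a * q ^ j) q (n - j).
Proof. intros Hj; rewrite <- qpoch_add; f_equal; lia. Qed.

Lemma askey_wilson_cleared (n : nat) (z a b c d : C) (q : R) :
  (0 < q < 1)%R ->
  qpoch (a * b) q n <> 0 -> qpoch (a * c) q n <> 0 -> qpoch (a * d) q n <> 0 ->
  askey_wilson n z a b c d q = aw_cleared n z a b c d q.
Proof.
intros Hq Hb Hc Hd; unfold askey_wilson, aw_cleared.
rewrite phi43_terminating, qpow_pred by easy.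
rewrite <- Cmult_assoc; f_equal; rewrite <- csum_scal; apply csum_ext; intros j Hj.
unfold qpochs; cbn [fold_right].
assert (Hjn : (j <= n)%nat) by lia.
rewrite (qpoch_split (a * b) q j n), (qpoch_split (a * c) q j n),
  (qpoch_split (a * d) q j n) by easy.
assert (N1 := qpoch_neq_0_le _ _ _ _ Hjn Hb).
assert (N2 := qpoch_neq_0_le _ _ _ _ Hjn Hc).
assert (N3 := qpoch_neq_0_le _ _ _ _ Hjn Hd).
field; repeat split; easy.
Qed.

Lemma qpoch_inv_shift (y : C) (q : R) (j k : nat) :
  (0 < q < 1)%R -> y <> 0 ->
  qpoch (y / q ^ j) q k * (q ^ j) ^ k * qpoch (q / q ^ k / y) q j
  = qpoch y q k * qpoch (q / y) q j.
Proof.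
intros Hq Hy; assert (Hq0 := Cq_neq_0 q Hq).
assert (Hk := Cpow_nz q k Hq0).
induction j as [|j IH].
- simpl (_ ^ 0); rewrite Cpow_1_l; simpl (qpoch _ _ 0).
  replace (y / 1) with y by (field; apply C1_nz); ring.
- assert (Hj := Cpow_nz q j Hq0).
  assert (E : qpoch (y / q ^ S j) q k * (1 - y / q ^ S j * q ^ k)
     = (1 - y / q ^ S j) * qpoch (y / q ^ j) q k).
  { transitivity (qpoch (y / q ^ S j) q (S k)); [easy|].
    rewrite qpoch_shift; do 2 f_equal; rewrite Cpow_S; field; easy. }
  cbn [qpoch]; rewrite Cpow_S, Cpow_mult_l.
  transitivity (qpoch (q / q ^ k / y) q j * (q ^ j) ^ k
    * (qpoch (y / q ^ S j) q k * (1 - y / q ^ S j * q ^ k)) * - (q * q ^ j / y)).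
  + rewrite Cpow_S; field; repeat split; easy.
  + rewrite E.
    transitivity (qpoch (y / q ^ j) q k * (q ^ j) ^ k * qpoch (q / q ^ k / y) q j
      * (1 - q / y * q ^ j)); [rewrite Cpow_S; field; repeat split; easy|].
    rewrite IH; ring.
Qed.

Lemma is_CInt_csum (f : nat -> R -> C) (l : nat -> C) (a b : R) (n : nat) :
  (forall j, (j < n)%nat -> is_CInt (f j) a b (l j)) ->
  is_CInt (fun t => csum (fun j => f j t) n) a b (csum l n).
Proof.
induction n as [|n IH]; intros H; simpl.
- assert (H0 := is_CInt_const 0 a b); rewrite Cmult_0_r in H0; exact H0.
- apply is_CInt_plus; [apply IH; auto with arith|apply H; lia].
Qed.

Lemma qpoch_inf_split (u v : C) (q : R) (n : nat) :
  (0 < q < 1)%R -> v = u * q ^ n -> qpoch_inf u q = qpoch u q n * qpoch_inf v q.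
Proof. intros Hq ->; apply qpoch_inf_shift, Hq. Qed.

Lemma aw_weight_absorb (z a b c f : C) (q : R) (i j : nat) :
  (0 < q < 1)%R -> Cmod z = 1%R ->
  (Cmod a < 1)%R -> (Cmod b < 1)%R -> (Cmod c < 1)%R -> (Cmod f < 1)%R ->
  qpoch (a * z) q i * qpoch (a / z) q i * (qpoch (c * z) q j * qpoch (c / z) q j)
    * aw_weight z a b c f q
  = aw_weight z (a * q ^ i) b (c * q ^ j) f q.
Proof.
intros Hq Hz Ha Hb Hc Hf.
assert (Hz0 : z <> 0) by (apply Cmod_gt_0; lra).
unfold aw_weight, qpochs_inf; cbn [fold_right].
rewrite (qpoch_inf_split (a * z) (a * q ^ i * z) q i Hq ltac:(ring)).
rewrite (qpoch_inf_split (a / z) (a * q ^ i / z) q i Hq ltac:(field; easy)).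
rewrite (qpoch_inf_split (c * z) (c * q ^ j * z) q j Hq ltac:(ring)).
rewrite (qpoch_inf_split (c / z) (c * q ^ j / z) q j Hq ltac:(field; easy)).
assert (N : forall t m, (Cmod t < 1)%R ->
  (qpoch (t * z) q m <> 0 /\ qpoch (t / z) q m <> 0) /\
  (qpoch_inf (t * z) q <> 0 /\ qpoch_inf (t / z) q <> 0)).
{ intros t m Ht; repeat split; (apply qpoch_neq_0 || apply qpoch_inf_neq_0); try easy;
    rewrite ?Cmod_mult_unit, ?Cmod_div_unit; easy. }
destruct (N a i Ha) as [[? ?] _]; destruct (N c j Hc) as [[? ?] _].
destruct (N b i Hb) as [_ [? ?]]; destruct (N f i Hf) as [_ [? ?]].
destruct (N (a * q ^ i) i (Cmod_qpow_lt_1 a q i Hq Ha)) as [_ [? ?]].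
destruct (N (c * q ^ j) i (Cmod_qpow_lt_1 c q j Hq Hc)) as [_ [? ?]].
field; repeat split; easy.
Qed.

Definition aw_moment (a b c f : C) (q : R) (i j : nat) : C :=
  2 * PI * qpoch_inf (a * b * c * f * q ^ j * q ^ i) q
  / (qpoch_inf q q * qpochs_inf [a * b * q ^ i; a * c * q ^ j * q ^ i; a * f * q ^ i;
       b * c * q ^ j; b * f; c * f * q ^ j] q).

Lemma aw_moment_spec (a b c f : C) (q : R) (i j : nat) :
  (0 < q < 1)%R ->
  (Cmod a < 1)%R -> (Cmod b < 1)%R -> (Cmod c < 1)%R -> (Cmod f < 1)%R ->
  is_CInt (fun x => qpoch (a * zof x) q i * qpoch (a / zof x) q i
       * (qpoch (c * zof x) q j * qpoch (c / zof x) q j)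
       * aw_weight (zof x) a b c f q * RtoC (/ sqrt (1 - x ^ 2)))
    (-1) 1 (aw_moment a b c f q i j).
Proof.
intros Hq Ha Hb Hc Hf.
assert (Ha' := Cmod_qpow_lt_1 a q i Hq Ha); assert (Hc' := Cmod_qpow_lt_1 c q j Hq Hc).
assert (H := aw_real_integral (a * q ^ i) b (c * q ^ j) f q Hq Ha' Hb Hc' Hf).
replace (aw_moment a b c f q i j) with (aw_circle (a * q ^ i) b (c * q ^ j) f q / 2).
- refine (is_CInt_ext _ _ _ _ _ _ H); intros x Hx.
  rewrite Rmin_left, Rmax_right in Hx by lra.
  rewrite <- aw_weight_absorb; try easy; apply Cmod_zof; lra.
- rewrite askey_wilson_circle by easy; unfold aw_moment.
  replace (a * q ^ i * b * (c * q ^ j) * f) with (a * b * c * f * q ^ j * q ^ i) by ring.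
  replace (a * q ^ i * b) with (a * b * q ^ i) by ring.
  replace (a * q ^ i * (c * q ^ j)) with (a * c * q ^ j * q ^ i) by ring.
  replace (a * q ^ i * f) with (a * f * q ^ i) by ring.
  replace (b * (c * q ^ j)) with (b * c * q ^ j) by ring.
  replace (c * q ^ j * f) with (c * f * q ^ j) by ring.
  replace (4 * PI)%R with (2 * (2 * PI))%R by ring.
  rewrite RtoC_mult, RtoC_mult; unfold Cdiv.
  rewrite <- (Cmult_1_l (2 * PI * _ * _)), <- (Cinv_r 2) at 1 by (apply RtoC_neq_0; lra).
  ring.
Qed.

Definition aw_coef (n : nat) (a b c d : C) (q : R) (j : nat) : C :=
  qbin_inv q n j * qpoch (q ^ n / q * (a * b * c * d)) q j
  * (qpoch (a * b * q ^ j) q (n - j) * qpoch (a * c * q ^ j) q (n - j)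
     * qpoch (a * d * q ^ j) q (n - j)).

Lemma aw_integral_double_sum (n k : nat) (q : R) (a b c d e f : C) :
  (0 < q < 1)%R ->
  a <> 0 -> c <> 0 -> d <> 0 ->
  (Cmod a < 1)%R -> (Cmod b < 1)%R -> (Cmod c < 1)%R -> (Cmod f < 1)%R ->
  qpoch (a * d) q n <> 0 -> qpoch (a * e) q k <> 0 ->
  aw_integral n k a b c d e f q
  = csum (fun j => / c ^ n * aw_coef n c b a d q j
      * csum (fun i => / a ^ k * aw_coef k a b e f q i * aw_moment a b c f q i j) (S k)) (S n).
Proof.
intros Hq Ha0 Hc0 Hd0 Ha Hb Hc Hf Had Hae.
apply (is_RInt_unique (V := C_R_CompleteNormedModule)).
assert (H := is_CInt_csum _ _ (-1) 1 (S n) (fun j _ =>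
  is_CInt_scal (/ c ^ n * aw_coef n c b a d q j) _ _ _ _
   (is_CInt_csum _ _ (-1) 1 (S k) (fun i _ =>
     is_CInt_scal (/ a ^ k * aw_coef k a b e f q i) _ _ _ _
       (aw_moment_spec a b c f q i j Hq Ha Hb Hc Hf))))).
refine (is_CInt_ext _ _ _ _ _ _ H); intros x Hx; clear H.
rewrite Rmin_left, Rmax_right in Hx by lra.
assert (Hz := Cmod_zof x ltac:(lra)); set (z := zof x) in *.
assert (Hz0 : z <> 0) by (apply Cmod_gt_0; lra).
rewrite !askey_wilson_cleared; try easy;
  try (apply qpoch_neq_0; [easy|apply Cmod_mult_lt_1; easy]).
rewrite (aw_cleared_sym n z a b c d) by easy.
set (w := aw_weight z a b c f q * RtoC (/ sqrt (1 - x ^ 2))).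
unfold aw_cleared.
transitivity ((/ c ^ n * w * (/ a ^ k * csum (fun i => aw_coef k a b e f q i
   * (qpoch (a * z) q i * qpoch (a / z) q i)) (S k)))
  * csum (fun j => aw_coef n c b a d q j
   * (qpoch (c * z) q j * qpoch (c / z) q j)) (S n)).
2:{ unfold w, aw_coef; ring. }
rewrite <- csum_scal; apply csum_ext; intros j _.
rewrite (csum_ext _ (fun i => (/ a ^ k * (qpoch (c * z) q j * qpoch (c / z) q j) * w)
   * (aw_coef k a b e f q i * (qpoch (a * z) q i * qpoch (a / z) q i)))).
- rewrite csum_scal; ring.
- intros i _; unfold w; ring.
Qed.

Lemma aw_inner_sum (k j : nat) (q : R) (a b c e f : C) :
  (0 < q < 1)%R ->
  a <> 0 -> b <> 0 -> c <> 0 -> f <> 0 ->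
  (Cmod a < 1)%R -> (Cmod b < 1)%R -> (Cmod c < 1)%R -> (Cmod f < 1)%R ->
  csum (fun i => / a ^ k * aw_coef k a b e f q i * aw_moment a b c f q i j) (S k)
  = 2 * PI * qpoch_inf (a * b * c * f * q ^ j * q ^ k) q
    / (qpoch_inf q q * qpochs_inf [a * b * q ^ k; a * c * q ^ j; a * f * q ^ k;
         b * c * q ^ j; b * f * q ^ k; c * f * q ^ j] q)
    * (c * q ^ j) ^ k * qpoch (e / c / q ^ j) q k.
Proof.
intros Hq Ha0 Hb0 Hc0 Hf0 Ha Hb Hc Hf.
assert (Hq0 := Cq_neq_0 q Hq); assert (Hj := Cpow_nz q j Hq0).
assert (P0 : forall u, (Cmod u < 1)%R -> qpoch_inf u q <> 0)
  by (intros; apply qpoch_inf_neq_0; easy).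
assert (Hq1 : (Cmod q < 1)%R) by (rewrite Cmod_q; lra).
assert (S0 : forall u v m, (Cmod u < 1)%R -> (Cmod v < 1)%R ->
  (Cmod (u * v * q ^ m) < 1)%R)
  by (intros; apply Cmod_qpow_lt_1, Cmod_mult_lt_1; easy).
set (B := a * c * q ^ j); set (u := e / c / q ^ j); set (v := b * f).
set (Kj := 2 * PI * qpoch_inf (a * b * c * f * q ^ j * q ^ k) q
    / (qpoch_inf q q * qpochs_inf [a * b * q ^ k; a * c * q ^ j; a * f * q ^ k;
         b * c * q ^ j; b * f; c * f * q ^ j] q)).
rewrite (csum_ext _ (fun i => / a ^ k * Kj * (qbin_inv q k i
  * qpoch (B * u * v * q ^ k / q) q i * qpoch B q i
  * qpoch (B * u * q ^ i) q (k - i) * qpoch (B * v * q ^ i) q (k - i)))).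
- rewrite csum_scal, q_saalschutz_balanced; try easy.
  2, 3: repeat apply Cmult_neq_0; easy.
  unfold Kj, B, v, qpochs_inf; cbn [fold_right].
  rewrite (qpoch_inf_split (b * f) (b * f * q ^ k) q k Hq eq_refl).
  replace (a * c * q ^ j) with (a * (c * q ^ j)) at 2 by ring; rewrite Cpow_mult_l.
  assert (N1 : qpoch (b * f) q k <> 0) by (apply qpoch_neq_0, Cmod_mult_lt_1; easy).
  assert (N2 : a ^ k <> 0) by (apply Cpow_nz; easy).
  field; repeat split; try easy; apply P0; try easy; apply S0; easy.
- intros i Hi; assert (Hik : (i <= k)%nat) by lia.
  unfold aw_coef, aw_moment, Kj, qpochs_inf; cbn [fold_right].
  replace (B * u * v * q ^ k / q) with (q ^ k / q * (a * b * e * f))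
    by (unfold B, u, v; field; easy).
  replace (B * u * q ^ i) with (a * e * q ^ i) by (unfold B, u; field; easy).
  replace (B * v * q ^ i) with (a * b * c * f * q ^ j * q ^ i) by (unfold B, v; ring).
  assert (Eq : forall t, t * q ^ k = t * q ^ i * q ^ (k - i)).
  { intros t; rewrite <- Cmult_assoc, <- Cpow_add_r; do 2 f_equal; lia. }
  rewrite (qpoch_inf_split (a * b * q ^ i) _ q (k - i) Hq (Eq (a * b))).
  rewrite (qpoch_inf_split (a * f * q ^ i) _ q (k - i) Hq (Eq (a * f))).
  rewrite (qpoch_inf_split (a * b * c * f * q ^ j * q ^ i) _ q (k - i) Hq
    (Eq (a * b * c * f * q ^ j))).
  rewrite (qpoch_inf_split (a * c * q ^ j) (a * c * q ^ j * q ^ i) q i Hq eq_refl).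
  fold B.
  assert (HB : (Cmod B < 1)%R) by (apply S0; easy).
  assert (N1 : qpoch (a * b * q ^ i) q (k - i) <> 0) by (apply qpoch_neq_0; auto).
  assert (N2 : qpoch (a * f * q ^ i) q (k - i) <> 0) by (apply qpoch_neq_0; auto).
  assert (N3 : qpoch B q i <> 0) by (apply qpoch_neq_0; auto).
  assert (N4 : qpoch_inf (B * q ^ i) q <> 0) by (apply P0, Cmod_qpow_lt_1; easy).
  assert (N5 : a ^ k <> 0) by (apply Cpow_nz; easy).
  field; repeat split; try easy; apply P0; auto; apply Cmod_mult_lt_1; easy.
Qed.

Lemma phi43_eq_aw_integral (n k : nat) (q : R) (a b c d e f : C) :
  (0 < q < 1)%R ->
  a <> 0 -> b <> 0 -> c <> 0 -> d <> 0 -> e <> 0 -> f <> 0 ->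
  (Cmod a < 1)%R -> (Cmod b < 1)%R -> (Cmod c < 1)%R -> (Cmod f < 1)%R ->
  qpoch (a * d) q n <> 0 -> qpoch (a * e) q k <> 0 -> qpoch (c * d) q n <> 0 ->
  qpoch (qpow q (1 - Z.of_nat k) * (c / e)) q n <> 0 -> qpoch (e / c) q k <> 0 ->
  phi43 (qpow q (- Z.of_nat n)) (qpow q (Z.of_nat n - 1) * (a * b * c * d))
        (c * f) (q * c / e)
        (c * d) (q ^ k * (a * b * c * f)) (qpow q (1 - Z.of_nat k) * (c / e))
        q q
  = c ^ n / c ^ k
    * (qpochs_inf [RtoC q; c * f; q ^ n * (a * c); q ^ n * (b * c);
                   q ^ k * (a * b); q ^ k * (a * f); q ^ k * (b * f)] q
       / (2 * PI * qpoch (c * d) q n * qpoch (e / c) q k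
          * qpoch_inf (q ^ k * (a * b * c * f)) q))
    * aw_integral n k a b c d e f q.
Proof.
intros Hq Ha0 Hb0 Hc0 Hd0 He0 Hf0 Ha Hb Hc Hf Had Hae Hcd Hce Hec.
assert (Hq0 := Cq_neq_0 q Hq).
rewrite phi43_terminating, aw_integral_double_sum by easy.
rewrite <- csum_scal; apply csum_ext; intros j Hj.
assert (Hjn : (j <= n)%nat) by lia.
rewrite aw_inner_sum by easy.
rewrite qpow_one_minus in * by easy; rewrite qpow_pred by easy.
assert (Hjq := Cpow_nz q j Hq0); assert (Hkq := Cpow_nz q k Hq0).
assert (Hq1 : (Cmod q < 1)%R) by (rewrite Cmod_q; lra).
assert (P0 : forall u, (Cmod u < 1)%R -> qpoch_inf u q <> 0)
  by (intros; apply qpoch_inf_neq_0; easy).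
assert (S0 : forall u v m, (Cmod u < 1)%R -> (Cmod v < 1)%R ->
  (Cmod (u * v * q ^ m) < 1)%R)
  by (intros; apply Cmod_qpow_lt_1, Cmod_mult_lt_1; easy).
assert (S4 : forall m, (Cmod (a * b * c * f * q ^ m) < 1)%R)
  by (intros; apply Cmod_qpow_lt_1; repeat apply Cmod_mult_lt_1; easy).
replace (q / q ^ k * (c / e)) with (q / q ^ k / (e / c)) in * by (field; easy).
replace (q * c / e) with (q / (e / c)) by (field; easy).
assert (Hy : e / c <> 0) by (apply Cmult_neq_0; [easy|apply Cinv_neq_0; easy]).
assert (E := qpoch_inv_shift (e / c) q j k Hq Hy).
set (y := e / c) in *.
assert (Hce' := qpoch_neq_0_le _ _ _ _ Hjn Hce).
assert (Hcd' := qpoch_neq_0_le _ _ _ _ Hjn Hcd).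
rewrite Cpow_mult_l.
unfold aw_coef, qpochs_inf; cbn [fold_right].
replace (c * b * a * d) with (a * b * c * d) by ring.
rewrite (Cmult_comm c b), (Cmult_comm c a).
rewrite (Cmult_comm (q ^ n) (a * c)), (Cmult_comm (q ^ n) (b * c)),
  (Cmult_comm (q ^ k) (a * b)), (Cmult_comm (q ^ k) (a * f)), (Cmult_comm (q ^ k) (b * f)),
  (Cmult_comm (q ^ k) (a * b * c * f)).
assert (Eq : forall t, t * q ^ n = t * q ^ j * q ^ (n - j)).
{ intros t; rewrite <- Cmult_assoc, <- Cpow_add_r; do 2 f_equal; lia. }
rewrite (qpoch_inf_split (a * c * q ^ j) _ q (n - j) Hq (Eq (a * c))).
rewrite (qpoch_inf_split (b * c * q ^ j) _ q (n - j) Hq (Eq (b * c))).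
rewrite (qpoch_inf_split (c * f) (c * f * q ^ j) q j Hq eq_refl).
rewrite (qpoch_inf_split (a * b * c * f * q ^ k) (a * b * c * f * q ^ j * q ^ k) q j Hq
  ltac:(ring)).
rewrite (qpoch_split (c * d) q j n Hjn) in Hcd |- *.
assert (N1 : qpoch (c * d * q ^ j) q (n - j) <> 0)
  by (intros Z; apply Hcd; rewrite Z; ring).
assert (N2 : qpoch (a * b * c * f * q ^ k) q j <> 0) by (apply qpoch_neq_0; auto).
assert (N3 : qpoch (a * c * q ^ j) q (n - j) <> 0) by (apply qpoch_neq_0; auto).
assert (N4 : qpoch (b * c * q ^ j) q (n - j) <> 0) by (apply qpoch_neq_0; auto).
assert (N5 : qpoch_inf (a * b * c * f * q ^ j * q ^ k) q <> 0)
  by (apply P0, Cmod_qpow_lt_1; auto).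
assert (N6 : c ^ n <> 0) by (apply Cpow_nz; easy).
assert (N7 : c ^ k <> 0) by (apply Cpow_nz; easy).
assert (N8 : RtoC PI <> 0) by (apply RtoC_neq_0, PI_neq0).
assert (N9 : RtoC 2 <> 0) by (apply RtoC_neq_0; lra).
assert (M1 := P0 _ Hq1); assert (M2 := P0 _ (S0 a b k Ha Hb)).
assert (M3 := P0 _ (S0 a f k Ha Hf)); assert (M4 := P0 _ (S0 b f k Hb Hf)).
assert (M5 := P0 _ (S0 a c n Ha Hc)); assert (M6 := P0 _ (S0 b c n Hb Hc)).
assert (M7 := P0 _ (S0 c f j Hc Hf)).
set (F1 := qpoch (q / y) q j) in *; set (F2 := qpoch y q k) in *.
set (F3 := qpoch (q / q ^ k / y) q j) in *.
set (F4 := qpoch (y / q ^ j) q k) in *; set (F5 := (q ^ j) ^ k) in *.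
replace F1 with (F4 * F5 * F3 / F2) by (rewrite E; field; easy).
field; repeat split; easy.
Qed.

Lemma askey_wilson_swap34 (n : nat) (z a b c d : C) (q : R) :
  askey_wilson n z a b c d q = askey_wilson n z a b d c q.
Proof.
unfold askey_wilson; f_equal; [unfold qpochs; cbn [fold_right]; ring|].
unfold phi43; f_equal; apply functional_extensionality; intros m.
apply sum_n_ext; intros j; unfold qpochs; cbn [fold_right].
replace (a * b * d * c) with (a * b * c * d) by ring.
now rewrite (Cmult_assoc (qpoch (a * c) q j)), (Cmult_comm (qpoch (a * c) q j)),
  <- (Cmult_assoc (qpoch (a * d) q j)).
Qed.

Lemma aw_integral_swap (n k : nat) (a b c d e f : C) (q : R) :
  aw_integral k n a b f e d c q = aw_integral n k a b c d e f q.
Proof.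
apply (RInt_ext (V := C_R_CompleteNormedModule)); intros x _.
rewrite (askey_wilson_swap34 k _ a b f e), (askey_wilson_swap34 n _ a b d c).
replace (aw_weight (zof x) a b f c q) with (aw_weight (zof x) a b c f q).
{ match goal with |- ?u = ?v => change (@eq C u v) end; ring. }
unfold aw_weight, Cdiv; do 2 f_equal; unfold qpochs_inf; cbn [fold_right]; ring.
Qed.

(* The eight hypotheses [qpoch _ _ _ <> 0] say that no denominator vanishes: the
   first two concern the 4phi3 in p_n(x;a,b,c,d|q) and p_k(x;a,b,e,f|q), the next
   three the first identity, the last three the second one.  The remaining
   denominators are nonzero because |a|, |b|, |c|, |f| < 1 and 0 < q < 1. *)
Theorem corollary7p2 (n k : nat) (q : R) (a b c d e f : C)
  (hq : (0 < q < 1)%R)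
  (ha0 : a <> 0) (hb0 : b <> 0) (hc0 : c <> 0)
  (hd0 : d <> 0) (he0 : e <> 0) (hf0 : f <> 0)
  (ha : (Cmod a < 1)%R) (hb : (Cmod b < 1)%R)
  (hc : (Cmod c < 1)%R) (hf : (Cmod f < 1)%R)
  (had : qpoch (a * d) q n <> 0)
  (hae : qpoch (a * e) q k <> 0)
  (hcd : qpoch (c * d) q n <> 0)
  (hce : qpoch (qpow q (1 - Z.of_nat k) * (c / e)) q n <> 0)
  (hec : qpoch (e / c) q k <> 0)
  (hef : qpoch (e * f) q k <> 0)
  (hfd : qpoch (qpow q (1 - Z.of_nat n) * (f / d)) q k <> 0)
  (hdf : qpoch (d / f) q n <> 0) :
  phi43 (qpow q (- Z.of_nat n)) (qpow q (Z.of_nat n - 1) * (a * b * c * d))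
        (c * f) (q * c / e)
        (c * d) (q ^ k * (a * b * c * f)) (qpow q (1 - Z.of_nat k) * (c / e))
        q q
  = c ^ n / c ^ k
    * (qpochs_inf [RtoC q; c * f; q ^ n * (a * c); q ^ n * (b * c);
                   q ^ k * (a * b); q ^ k * (a * f); q ^ k * (b * f)] q
       / (2 * PI * qpoch (c * d) q n * qpoch (e / c) q k
          * qpoch_inf (q ^ k * (a * b * c * f)) q))
    * aw_integral n k a b c d e f q
  /\
  phi43 (qpow q (- Z.of_nat k)) (qpow q (Z.of_nat k - 1) * (a * b * e * f))
        (c * f) (q * f / d)
        (e * f) (q ^ n * (a * b * c * f)) (qpow q (1 - Z.of_nat n) * (f / d))
        q q
  = f ^ k / f ^ n
    * (qpochs_inf [RtoC q; c * f; q ^ n * (a * b); q ^ n * (a * c);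
                   q ^ n * (b * c); q ^ k * (a * f); q ^ k * (b * f)] q
       / (2 * PI * qpoch (d / f) q n * qpoch (e * f) q k
          * qpoch_inf (q ^ n * (a * b * c * f)) q))
    * aw_integral n k a b c d e f q.
Proof.
split; [apply phi43_eq_aw_integral; easy|].
assert (Had' : qpoch (f * e) q k <> 0) by (rewrite Cmult_comm; easy).
assert (H := phi43_eq_aw_integral k n q a b f e d c hq ha0 hb0 hf0 he0 hd0 hc0 ha hb hf hc
  hae had Had' hfd hdf).
rewrite aw_integral_swap in H.
replace (a * b * f * e) with (a * b * e * f) in H by ring.
replace (a * b * f * c) with (a * b * c * f) in H by ring.
rewrite (Cmult_comm f c), (Cmult_comm f e) in H.
rewrite H; f_equal; f_equal; unfold Cdiv; f_equal.
- unfold qpochs_inf; cbn [fold_right]; ring.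
- f_equal; ring.
Qed.
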